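(* Let $(X,\oplus,\odot,d)$ be any one of the spaces listed in the context and let $\mathbf L(X)$ be either $\mathcal L(X)$ or $\mathcal L^+(X)$. If $(A_j)_{j\in J}\subset\mathbf L(X)$ is pointwise bounded, i.e. for every $x\in X$ there is $M_x$ with $\|A_j(x)\|_{\mathcal F}=d(A_j(x),\tilde0)\le M_x$ for all $j\in J$, then there exists $M>0$ with $|||A_j|||_{\mathcal F}\le M$ for all $j\in J$.
   Context: Fuzzy numbers $\mathbb{R}_{\mathcal F}$: functions $u:\mathbb{R}\to[0,1]$ that are normal, fuzzy convex, upper semicontinuous, with compact support closure; level sets $[u]^r=[u_-(r),u_+(r)]$; $[u\oplus v]^r=[u]^r+[v]^r$, $[\lambda\odot u]^r=\lambda[u]^r$, $\tilde0=\chi_{\{0\}}$; $D(u,v)=\sup_{r\in[0,1]}\max\{|u_-(r)-v_-(r)|,|u_+(r)-v_+(r)|\}$. The admissible spaces $(X,\oplus,\odot,d)$ (operations pointwise/componentwise): $(\mathbb{R}_{\mathcal F},D)$; $C([a,b];\mathbb{R}_{\mathcal F})$ with sup-metric $D^*$; $L^p([a,b];\mathbb{R}_{\mathcal F})$ ($1\le p<\infty$) with $D_p(f,g)=(\int_a^bD(f,g)^p)^{1/p}$; $C^p([a,b];\mathbb{R}_{\mathcal F})$ with $D_p^*(f,g)=\sum_{i=0}^pD^*(f^{(i)},g^{(i)})$; $l^p_{\mathbb{R}_{\mathcal F}}$ with $\rho_p$; $m_{\mathbb{R}_{\mathcal F}}$, $c_{\mathbb{R}_{\mathcal F}}$, $c^{\tilde0}_{\mathbb{R}_{\mathcal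 F}}$ with $\mu(x,y)=\sup_nD(x_n,y_n)$; finite Cartesian products with max metric. $\|x\|_{\mathcal F}=d(\tilde0,x)$. $\mathcal L^+(X)$: maps $A:X\to X$ additive ($A(x\oplus y)=A(x)\oplus A(y)$), positive homogeneous ($A(\lambda\odot x)=\lambda\odot A(x)$, $\lambda\ge0$) and continuous at every point; $\mathcal L(X)$: maps that are additive, satisfy $A(\lambda\odot x)=\lambda\odot A(x)$ for all $\lambda\in\mathbb{R}$, and are continuous at every point. $|||A|||_{\mathcal F}=\inf\{M>0:\|A(x)\|_{\mathcal F}\le M\|x\|_{\mathcal F}\ \forall x\}$. *)

(* Defs.v *)
From HB Require Import structures.
From mathcomp Require Import all_boot all_order all_algebra.
From mathcomp Require Import all_classical all_reals all_analysis.
From Stdlib Require Import ClassicalEpsilon.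
Set Implicit Arguments. Unset Strict Implicit. Unset Printing Implicit Defensive.
Import Order.TTheory GRing.Theory Num.Theory.
Import numFieldNormedType.Exports.
Local Open Scope classical_set_scope.
Local Open Scope ring_scope.

Section Fuzzy.
Variable R : realType.

Definition fuzzy_support (u : R -> R) : set R := closure [set x | 0 < u x].

Definition is_fuzzy (u : R -> R) : Prop :=
  [/\ (forall x, 0 <= u x <= 1),
      (exists x, u x = 1),
      (forall x y t, 0 <= t <= 1 ->
          Num.min (u x) (u y) <= u (t * x + (1 - t) * y)),
      (forall x e, 0 < e -> exists2 d, 0 < d &
          forall y, `|y - x| < d -> u y < u x + e)
    & compact (fuzzy_support u)].

Definition level (u : R -> R) (r : R) : set R :=
  if r == 0 then fuzzy_support u else [set x | r <= u x].
Definition lower (u : R -> R) (r : R) : R := inf (level u r).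
Definition upper (u : R -> R) (r : R) : R := sup (level u r).

Definition Dist (u v : R -> R) : R :=
  sup [set Num.max `|lower u r - lower v r| `|upper u r - upper v r| | r in [set r | 0 <= r <= 1]].

(* the fuzzy zero, addition (Zadeh extension) and scalar multiplication *)
Definition fzero : R -> R := fun x => if x == 0 then 1 else 0.
Definition fadd (u v : R -> R) : R -> R :=
  fun x => sup (range (fun y => Num.min (u y) (v (x - y)))).
Definition fsmul (l : R) (u : R -> R) : R -> R :=
  if l == 0 then fzero else fun x => u (x / l).

Record fspace := FSpace {
  car : Type;
  inX : car -> Prop;
  sadd : car -> car -> car;
  ssmul : R -> car -> car;
  szero : car;
  sdist : car -> car -> R }.

Definition snorm (X : fspace) (x : car X) : R := sdist (szero X) x.

Definition RF_space : fspace := @FSpace (R -> R) is_fuzzy fadd fsmul fzero Dist.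

Definition itv (a b : R) : set R := [set t | a <= t <= b].
Definition fpadd (f g : R -> R -> R) : R -> R -> R := fun t => fadd (f t) (g t).
Definition fpsmul (l : R) (f : R -> R -> R) : R -> R -> R := fun t => fsmul l (f t).
Definition fpzero : R -> R -> R := fun _ => fzero.

Definition C_mem (a b : R) (f : R -> R -> R) : Prop :=
  (forall t, a <= t <= b -> is_fuzzy (f t)) /\
  (forall t, a <= t <= b -> forall e, 0 < e -> exists2 d, 0 < d &
      forall s, a <= s <= b -> `|s - t| < d -> Dist (f s) (f t) < e).
Definition Cdist (a b : R) (f g : R -> R -> R) : R :=
  sup [set Dist (f t) (g t) | t in [set t | a <= t <= b]].
Definition C_space (a b : R) : fspace :=
  @FSpace (R -> R -> R) (C_mem a b) fpadd fpsmul fpzero (Cdist a b).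

(* ---------- L^p([a,b]; R_F) (functions, D_p a pseudometric) ---------- *)
Definition Lp_mem (a b p : R) (f : R -> R -> R) : Prop :=
  [/\ (forall t, a <= t <= b -> is_fuzzy (f t)),
      (forall r, 0 <= r <= 1 ->
          measurable_fun (itv a b) (fun t => lower (f t) r) /\
          measurable_fun (itv a b) (fun t => upper (f t) r))
    & (\int[lebesgue_measure]_(t in itv a b)
          ((Dist (f t) fzero) `^ p)%R%:E < +oo)%E].
Definition Lpdist (a b p : R) (f g : R -> R -> R) : R :=
  (fine (\int[lebesgue_measure]_(t in itv a b)
          ((Dist (f t) (g t)) `^ p)%R%:E)%E) `^ p^-1.
Definition Lp_space (a b p : R) : fspace :=
  @FSpace (R -> R -> R) (Lp_mem a b p) fpadd fpsmul fpzero (Lpdist a b p).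

(* w is the (one-sided at the end points) Hukuhara derivative of f at t on [a,b] *)
Definition Hderiv_at (a b : R) (f : R -> R -> R) (t : R) (w : R -> R) : Prop :=
  (t < b -> forall e, 0 < e -> exists2 d, 0 < d & forall h, 0 < h < d -> t + h <= b ->
      exists2 z, is_fuzzy z & f (t + h) = fadd (f t) z /\ Dist (fsmul h^-1 z) w < e) /\
  (a < t -> forall e, 0 < e -> exists2 d, 0 < d & forall h, 0 < h < d -> a <= t - h ->
      exists2 z, is_fuzzy z & f t = fadd (f (t - h)) z /\ Dist (fsmul h^-1 z) w < e).

Definition Hdiff_on (a b : R) (f : R -> R -> R) : Prop :=
  forall t, a <= t <= b -> exists2 w, is_fuzzy w & Hderiv_at a b f t w.

(* the derivative f' (a choice of the (unique) derivative at each point) *)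
Definition Hderiv (a b : R) (f : R -> R -> R) : R -> R -> R :=
  fun t => epsilon (inhabits fzero) (fun w => is_fuzzy w /\ Hderiv_at a b f t w).

Definition nderiv (a b : R) (i : nat) (f : R -> R -> R) : R -> R -> R :=
  iter i (Hderiv a b) f.

Definition Cp_mem (a b : R) (p : nat) (f : R -> R -> R) : Prop :=
  forall i : nat, (i <= p)%N ->
    C_mem a b (nderiv a b i f) /\ ((i < p)%N -> Hdiff_on a b (nderiv a b i f)).
Definition Cpdist (a b : R) (p : nat) (f g : R -> R -> R) : R :=
  \sum_(i < p.+1) Cdist a b (nderiv a b i f) (nderiv a b i g).
Definition Cp_space (a b : R) (p : nat) : fspace :=
  @FSpace (R -> R -> R) (Cp_mem a b p) fpadd fpsmul fpzero (Cpdist a b p).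

Definition fsadd (x y : nat -> R -> R) : nat -> R -> R := fun n => fadd (x n) (y n).
Definition fssmul (l : R) (x : nat -> R -> R) : nat -> R -> R := fun n => fsmul l (x n).
Definition fszero : nat -> R -> R := fun _ => fzero.

Definition lp_mem (p : R) (x : nat -> R -> R) : Prop :=
  (forall n, is_fuzzy (x n)) /\
  (\sum_(0 <= n <oo) ((Dist (x n) fzero) `^ p)%R%:E < +oo)%E.
Definition rho (p : R) (x y : nat -> R -> R) : R :=
  (fine (\sum_(0 <= n <oo) ((Dist (x n) (y n)) `^ p)%R%:E)%E) `^ p^-1.
Definition lp_space (p : R) : fspace :=
  @FSpace (nat -> R -> R) (lp_mem p) fsadd fssmul fszero (rho p).

Definition mu (x y : nat -> R -> R) : R := sup (range (fun n => Dist (x n) (y n))).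

Definition m_mem (x : nat -> R -> R) : Prop :=
  (forall n, is_fuzzy (x n)) /\ exists M, forall n, Dist (x n) fzero <= M.
Definition c_mem (x : nat -> R -> R) : Prop :=
  (forall n, is_fuzzy (x n)) /\ exists2 u, is_fuzzy u &
    forall e, 0 < e -> exists N, forall n, (N <= n)%N -> Dist (x n) u < e.
Definition c0_mem (x : nat -> R -> R) : Prop :=
  (forall n, is_fuzzy (x n)) /\
    forall e, 0 < e -> exists N, forall n, (N <= n)%N -> Dist (x n) fzero < e.

Definition m_space : fspace := @FSpace (nat -> R -> R) m_mem fsadd fssmul fszero mu.
Definition c_space : fspace := @FSpace (nat -> R -> R) c_mem fsadd fssmul fszero mu.
Definition c0_space : fspace := @FSpace (nat -> R -> R) c0_mem fsadd fssmul fszero mu.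

(* ---------- finite Cartesian products (max metric), built by binary products ---------- *)
Definition prod_space (X Y : fspace) : fspace :=
  @FSpace (car X * car Y)%type
    (fun z => inX z.1 /\ inX z.2)
    (fun z w => (sadd z.1 w.1, sadd z.2 w.2))
    (fun l z => (ssmul l z.1, ssmul l z.2))
    (szero X, szero Y)
    (fun z w => Num.max (sdist z.1 w.1) (sdist z.2 w.2)).

Inductive admissible : fspace -> Prop :=
  | adm_RF : admissible RF_space
  | adm_C a b : a < b -> admissible (C_space a b)
  | adm_Lp a b p : a < b -> 1 <= p -> admissible (Lp_space a b p)
  | adm_Cp a b (p : nat) : a < b -> admissible (Cp_space a b p)
  | adm_lp p : 1 <= p -> admissible (lp_space p)
  | adm_m : admissible m_space
  | adm_c : admissible c_space
  | adm_c0 : admissible c0_space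
  | adm_prod X Y : admissible X -> admissible Y -> admissible (prod_space X Y).

(* equality in X is taken as d(x,y) = 0 (this is equality in the quotient for L^p) *)
Definition maps_into (X : fspace) (A : car X -> car X) : Prop :=
  forall x, inX x -> inX (A x).
Definition is_additive (X : fspace) (A : car X -> car X) : Prop :=
  forall x y, inX x -> inX y -> sdist (A (sadd x y)) (sadd (A x) (A y)) = 0.
Definition is_poshom (X : fspace) (A : car X -> car X) : Prop :=
  forall (l : R) x, 0 <= l -> inX x -> sdist (A (ssmul l x)) (ssmul l (A x)) = 0.
Definition is_hom (X : fspace) (A : car X -> car X) : Prop :=
  forall (l : R) x, inX x -> sdist (A (ssmul l x)) (ssmul l (A x)) = 0.
Definition is_cont (X : fspace) (A : car X -> car X) : Prop :=
  forall x, inX x -> forall e, 0 < e -> exists2 d, 0 < d &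
    forall y, inX y -> sdist x y < d -> sdist (A x) (A y) < e.

Definition LF (X : fspace) (A : car X -> car X) : Prop :=
  [/\ maps_into A, is_additive A, is_hom A & is_cont A].
Definition LFplus (X : fspace) (A : car X -> car X) : Prop :=
  [/\ maps_into A, is_additive A, is_poshom A & is_cont A].

(* |||A||| as an extended real: inf of the empty set is +oo *)
Definition opnorm (X : fspace) (A : car X -> car X) : \bar R :=
  ereal_inf [set M%:E | M in [set M : R | 0 < M /\
                    forall x, inX x -> snorm (A x) <= M * snorm x]].

End Fuzzy.

(* Main.v *)
Require Import Defs.
From mathcomp Require Import all_boot all_order all_algebra.
From mathcomp Require Import all_classical all_reals all_analysis.
From mathcomp Require Import measurable_realfun ring lra.
From Stdlib Require ClassicalEpsilon.
Set Implicit Arguments. Unset Strict Implicit. Unset Printing Implicit Defensive.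
Import Order.TTheory GRing.Theory Num.Theory.
Import numFieldNormedType.Exports.
Local Open Scope classical_set_scope.
Local Open Scope ring_scope.

(** The operators are bounded near 0 uniformly, by a gliding hump. If not, one
    adds successively smaller elements y_n to build partial sums s_n together with
    indices j_n such that |A_(j_n) s_(n+1)| > n + 1; continuity of A_(j_n) and a
    fast enough decay of the y_n give |A_(j_n) x| > n for the sum x of the series.
    This uses only a translation invariant, positively homogeneous metric for
    which absolutely convergent series converge, and no subtraction.

    To see that the listed spaces have this property, a fuzzy number is encoded
    by the pair of its level functions (monotone, left continuous on (0, 1] and
    right continuous at 0), on which addition and scaling act pointwise and which
    are closed under uniform limits. In L^p a series converges wherever
    sum_k (2^k D(0, y_k(t)))^p is finite. In C^p, the derivative of a limit is
    the limit of the derivatives, by a mean value inequality for Hukuhara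
    differences. *)

(** * Uniform boundedness on complete metric cones *)

Section AbstractCone.
Variable R : realType.

(** The textbook argument recentres a ball at the origin by subtracting its centre. Here
    [x + (-1) x] is in general not zero, so a bound near some point cannot be transported to 0. What
    survives of the group structure is [d(x + y, x) = |y|]: together with additivity it turns a
    large value of [A] at [y] into a large value at [x + y], provided the value at [x] is under
    control. Pointwise boundedness at the partial sum already built supplies that control, uniformly
    in the index. The tail estimate only asks that the sizes of the terms be halved at each step.
    The ratio 1/4 leaves a spare factor [2^k] at the k-th term; L^p spends it on weights, which turn
    smallness of integrals into pointwise convergence. *)

Definition partial_sum (X : fspace R) (y : nat -> car X) : nat -> car X :=
  fix s n := if n is n'.+1 then sadd (s n') (y n') else szero X.

(** The axioms compare distances and never assert equality of elements: in L^p, and for functions on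
    a segment with arbitrary values outside it, distinct elements can be at distance 0. Translation
    invariance enters as [cone_addl]. *)
Record metric_cone (X : fspace R) : Prop := MetricCone {
  cone_zero : inX (szero X);
  cone_add : forall x y : car X, inX x -> inX y -> inX (sadd x y);
  cone_smul : forall l (x : car X), 0 <= l -> inX x -> inX (ssmul l x);
  cone_ge0 : forall x y : car X, inX x -> inX y -> 0 <= sdist x y;
  cone_sym : forall x y : car X, inX x -> inX y -> sdist x y = sdist y x;
  cone_tri : forall x y z : car X, inX x -> inX y -> inX z ->
    sdist x z <= sdist x y + sdist y z;
  cone_addl : forall x y : car X, inX x -> inX y ->
    sdist (sadd x y) x = snorm y;
  cone_norm_smul : forall l (x : car X), 0 <= l -> inX x ->
    snorm (ssmul l x) = l * snorm x }.

Definition series_complete (X : fspace R) : Prop :=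
  forall y : nat -> car X, (forall n, inX (y n)) ->
    (forall n, snorm (y n) <= 4^-1 ^+ n) ->
    exists2 x, inX x & forall e, 0 < e -> exists N, forall n, (N <= n)%N ->
      sdist (partial_sum y n) x <= e.

Section UniformBoundedness.
Variable X : fspace R.
Hypothesis gX : metric_cone X.

Lemma partial_sum_in (y : nat -> car X) n : (forall n, inX (y n)) -> inX (partial_sum y n).
Proof. by move=> yX; elim: n => [|n IH] /=; [exact: cone_zero|exact: cone_add]. Qed.

(** Induction on [k] for all [m] at once: the step from [m] to [m + 1] costs [c m], and the
    remaining [2 * c m.+1] is again at most [c m]. *)
Lemma partial_sum_cauchy (y : nat -> car X) (c : nat -> R) :
  (forall n, inX (y n)) -> (forall n, snorm (y n) <= c n) ->
  (forall n, 0 <= c n) -> (forall n, c n.+1 <= c n / 2) ->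
  forall k m, sdist (partial_sum y m) (partial_sum y (m + k)) <= 2 * c m.
Proof.
move=> yX yc c0 cS; have sX k := partial_sum_in k yX.
elim=> [|k IH] m.
  rewrite addn0.
  have := cone_tri gX (sX m) (sX m.+1) (sX m).
  rewrite (cone_sym gX (sX m) (sX m.+1)) /= cone_addl //.
  by move: (yc m); lra.
have := cone_tri gX (sX m) (sX m.+1) (sX (m + k.+1)%N).
rewrite addnS -addSn (cone_sym gX (sX m) (sX m.+1)) /= cone_addl // => /le_trans; apply.
by move: (IH m.+1) (yc m) (cS m) (c0 m); lra.
Qed.

(** Turns convergence without a rate into an explicit one, so that the limit provably lies in every
    ball fixed during the construction. *)
Lemma partial_sum_tail (y : nat -> car X) (c : nat -> R) (x : car X) :
  (forall n, inX (y n)) -> inX x -> (forall n, snorm (y n) <= c n) ->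
  (forall n, 0 <= c n) -> (forall n, c n.+1 <= c n / 2) ->
  (forall e, 0 < e -> exists N, forall n, (N <= n)%N -> sdist (partial_sum y n) x <= e) ->
  forall n, sdist (partial_sum y n) x <= 2 * c n.
Proof.
move=> yX xX yc c0 cS cvx n; apply/ler_addgt0Pr => e e0.
have [N HN] := cvx e e0.
have sX k := partial_sum_in k yX.
apply: le_trans (cone_tri gX (sX n) (sX (n + N)%N) xX) _.
apply: lerD; first exact: partial_sum_cauchy.
by apply: HN; rewrite leq_addl.
Qed.

Hypothesis cX : series_complete X.
Variables (J : Type) (A : J -> car X -> car X).
Hypothesis A_in : forall j, maps_into (A j).
Hypothesis A_add : forall j, is_additive (A j).
Hypothesis A_hom : forall j, is_poshom (A j).
Hypothesis A_cont : forall j, is_cont (A j).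
Hypothesis A_bounded : forall x, inX x -> exists Mx : R, forall j, snorm (A j x) <= Mx.

(* Additivity makes [|A x - A (x + y)| = |A y|]: a large value at [y] forces
   a large value at [x + y] whenever the value at [x] is controlled. *)
Lemma norm_image_add j x y : inX x -> inX y ->
  snorm (A j y) <= snorm (A j (sadd x y)) + snorm (A j x).
Proof.
move=> xX yX.
have Ax := A_in j xX; have Ay := A_in j yX.
have Axy := A_in j (cone_add gX xX yX).
have AxAy := cone_add gX Ax Ay; have Z := cone_zero gX.
rewrite -(cone_addl gX Ax Ay).
apply: le_trans (cone_tri gX AxAy Axy Ax) _.
rewrite (cone_sym gX AxAy Axy) A_add // add0r.
by apply: le_trans (cone_tri gX Axy Z Ax) _; rewrite (cone_sym gX Axy Z).
Qed.

(** The conclusion concerns every [x] in a ball around the new partial sum, since the limit of the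
    series is not known yet. In the bound [n + 1 + M], the [M] pays for [|A_j s|] and the 1 for the
    continuity error. *)
Lemma hump_step n (s : car X) (c : R) : inX s -> 0 < c ->
  (forall e K, 0 < e -> exists j x, [/\ inX x, snorm x <= e & K < snorm (A j x)]) ->
  exists y c', [/\ inX y, snorm y <= c, 0 < c', c' <= c / 4 &
    exists j, forall x, inX x -> sdist (sadd s y) x <= 2 * c' -> n%:R < snorm (A j x)].
Proof.
move=> sX c0 unb.
have [M HM] := A_bounded sX.
have [j [y [yX yc Ky]]] := unb c (n.+1%:R + M) c0.
have syX := cone_add gX sX yX.
have [d d0 Hd] := A_cont j syX ltr01.
(* [c / 4] enforces the decay of the terms; [d / 4] gives [2 * c' <= d / 2 < d], inside the
   continuity neighbourhood. *)
exists y, (Num.min (c / 4) (d / 4)); split=> //.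
- by rewrite lt_min !divr_gt0.
- by rewrite ge_min lexx.
exists j => x xX dx.
have dxd : sdist (sadd s y) x < d.
  apply: le_lt_trans dx _.
  have : Num.min (c / 4) (d / 4) <= d / 4 by rewrite ge_min lexx orbT.
  by lra.
have := Hd x xX dxd.
have := norm_image_add j sX yX.
have Z := cone_zero gX.
have := cone_tri gX Z (A_in j xX) (A_in j syX).
rewrite (cone_sym gX (A_in j xX) (A_in j syX)).
move: (HM j) Ky; rewrite -natr1 /snorm; lra.
Qed.

Lemma uniformly_bounded_near0 :
  exists e K, 0 < e /\ forall j x, inX x -> snorm x <= e -> snorm (A j x) <= K.
Proof.
apply: contrapT => nbd.
have unb e K : 0 < e -> exists j x, [/\ inX x, snorm x <= e & K < snorm (A j x)].
  move=> e0; apply: contrapT => H; apply: nbd; exists e, K; split=> // j x xX xe.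
  by rewrite leNgt; apply/negP => lt; apply: H; exists j, x.
(* A state is a partial sum together with the size allowed for the next term. *)
pose St := {p : car X * R | inX p.1 /\ 0 < p.2}.
have step (q : nat * St) : exists r : car X * R,
  [/\ inX r.1, snorm r.1 <= (sval q.2).2, 0 < r.2, r.2 <= (sval q.2).2 / 4 &
    exists j, forall x, inX x -> sdist (sadd (sval q.2).1 r.1) x <= 2 * r.2 ->
      q.1%:R < snorm (A j x)].
  case: q => n [[s c] /= [sX c0]].
  by have [y [c' H]] := hump_step n sX c0 unb; exists (y, c').
have [F HF] := choice step.
have nextP q : inX (sadd (sval q.2).1 (F q).1) /\ 0 < (F q).2.
  have [yX _ c0 _ _] := HF q; split=> //.
  by apply: cone_add => //; case: (svalP q.2).
pose nxt n (q : St) : St := exist _ (sadd (sval q).1 (F (n, q)).1, (F (n, q)).2) (nextP (n, q)).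
have init : inX (szero X, 1 : R).1 /\ 0 < (szero X, 1 : R).2.
  by split=> //; exact: cone_zero.
pose st := fix st n : St := if n is n'.+1 then nxt n' (st n') else exist _ (szero X, 1) init.
pose y n := (F (n, st n)).1; pose c n := (sval (st n)).2.
have yX n : inX (y n) by case: (HF (n, st n)).
have c0 n : 0 <= c n by apply: ltW; case: (svalP (st n)).
have cS n : c n.+1 <= c n / 4 by case: (HF (n, st n)).
have yc n : snorm (y n) <= c n by case: (HF (n, st n)).
have sE n : (sval (st n)).1 = partial_sum y n by elim: n => //= n ->.
have c4 n : c n <= 4^-1 ^+ n.
  elim: n => [|n IH]; first by rewrite expr0.
  rewrite exprS; move: (cS n) IH; lra.
have [x xX cvx] := cX yX (fun n => le_trans (yc n) (c4 n)).
have cS2 n : c n.+1 <= c n / 2 by move: (cS n) (c0 n); lra.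
have tail := partial_sum_tail yX xX yc c0 cS2 cvx.
have [M HM] := A_bounded xX.
have [n Mn] : exists n, M < n%:R.
  by exists (Num.bound `|M|); exact: le_lt_trans (ler_norm M) (archi_boundP (normr_ge0 M)).
(* The limit is within [2 * c n.+1] of the partial sum reached by step [n], so it lies in the ball
   of that step: [|A_j x| > n > M]. *)
have [_ _ _ _ [j /(_ x xX)]] := HF (n, st n).
rewrite /= sE => /(_ (tail n.+1)) /lt_le_trans /(_ (HM j)).
by move/(lt_trans Mn); rewrite ltxx.
Qed.

(** Rescales [x] to norm [e]. The 1 added to [|K|] makes [M] positive, as [opnorm] demands. *)
Lemma uniformly_bounded :
  exists2 M : R, 0 < M & forall j, (opnorm (A j) <= M%:E)%E.
Proof.
have [e [K [e0 HK]]] := uniformly_bounded_near0.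
have Z := cone_zero gX.
pose M := (`|K| + 1) / e.
have M0 : 0 < M by rewrite divr_gt0 // ltr_wpDl.
exists M => // j; apply: ereal_inf_lbound; exists M => //; split=> // x xX.
have scale l : 0 <= l -> l * snorm x <= e -> l * snorm (A j x) <= K.
  move=> l0 le; have lX := cone_smul gX l0 xX.
  have := HK j _ lX; rewrite cone_norm_smul // => /(_ le); apply: le_trans.
  rewrite -(cone_norm_smul gX l0 (A_in j xX)).
  have lA := cone_smul gX l0 (A_in j xX); have Al := A_in j lX.
  apply: le_trans (cone_tri gX Z Al lA) _.
  by rewrite A_hom // addr0.
have nx : 0 <= snorm x := cone_ge0 gX Z xX.
have nA : 0 <= snorm (A j x) := cone_ge0 gX Z (A_in j xX).
(* If [|x| = 0], all multiples of [x] stay in the small ball, so [l |A x| <= K] for every [l >= 0],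
   which forces [|A x| = 0]. *)
have [x0|xN0] := eqVneq (snorm x) 0.
  rewrite x0 mulr0 leNgt; apply/negP => Apos.
  have := scale ((`|K| + 1) / snorm (A j x)); rewrite x0 mulr0 divfK ?gt_eqF //.
  have KK := ler_norm K.
  have K0 := normr_ge0 K.
  have K1 : 0 <= `|K| + 1 by lra.
  by rewrite divr_ge0 // => /(_ isT (ltW e0)); lra.
have xpos : 0 < snorm x by rewrite lt_neqAle eq_sym xN0.
have := scale (e / snorm x); rewrite divfK // divr_ge0 // ?(ltW e0) //.
move=> /(_ isT (lexx _)).
rewrite mulrAC ler_pdivrMr // => H.
rewrite /M mulrAC ler_pdivlMr // mulrC; apply: le_trans H _.
by rewrite ler_pM2r //; have := ler_norm K; lra.
Qed.

End UniformBoundedness.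
End AbstractCone.

(** * Level functions of fuzzy numbers *)

Section FuzzyLevels.
Variable R : realType.
Implicit Types (u v w : R -> R) (l m : R -> R).

(* The conditions on the lower end points of the levels; those on the upper end
   points [m] are [lhalf (\- m)]. *)
Definition lhalf l : Prop :=
  [/\ forall r s, 0 <= r -> r <= s -> s <= 1 -> l r <= l s,
      forall r x, 0 < r <= 1 -> x < l r -> exists2 s, 0 < s < r & x < l s
    & forall x, l 0 < x -> exists2 r, 0 < r <= 1 & l r < x].

(** The Goetschel-Voxman conditions. By monotonicity, [l 1 <= m 1] orders the two ends at every
    level. *)
Definition level_pair l m : Prop := [/\ lhalf l, lhalf (\- m) & l 1 <= m 1].

(** Only the levels in (0, 1] occur. They determine [u], and level 0, the closed support, is
    recovered from right continuity at 0. *)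
Definition represents l m u : Prop :=
  (forall x, 0 <= u x <= 1) /\
  forall r x, 0 < r <= 1 -> (r <= u x <-> l r <= x <= m r).

(** Each summand gets half of the gap. By monotonicity the larger of the two indices serves both for
    left continuity, the smaller one at 0. *)
Lemma lhalfD l k : lhalf l -> lhalf k -> lhalf (l \+ k).
Proof.
move=> [l1 l2 l3] [k1 k2 k3]; split=> /=.
- by move=> r s r0 rs s1; apply: lerD; [exact: l1|exact: k1].
- move=> r x r01 xlt; pose e := (l r + k r - x) / 2.
  have e0 : 0 < e by rewrite /e; lra.
  have [||s s0r ls] := l2 r (l r - e); [by []|lra|].
  have [||t t0r kt] := k2 r (k r - e); [by []|lra|].
  exists (Num.max s t); first by rewrite lt_max gt_max; lra.
  have sM : s <= Num.max s t by rewrite le_max lexx.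
  have tM : t <= Num.max s t by rewrite le_max lexx orbT.
  have M1 : Num.max s t <= 1 by rewrite ge_max; lra.
  have := l1 s (Num.max s t) ltac:(lra) sM M1.
  have := k1 t (Num.max s t) ltac:(lra) tM M1.
  rewrite /e in ls kt; lra.
- move=> x xlt; pose e := (x - l 0 - k 0) / 2.
  have e0 : 0 < e by rewrite /e; lra.
  have [|s s0r ls] := l3 (l 0 + e); first lra.
  have [|t t0r kt] := k3 (k 0 + e); first lra.
  exists (Num.min s t); first by rewrite lt_min ge_min; lra.
  have sM : Num.min s t <= s by rewrite ge_min lexx.
  have tM : Num.min s t <= t by rewrite ge_min lexx orbT.
  have M0 : 0 <= Num.min s t by rewrite le_min; lra.
  have := l1 (Num.min s t) s M0 sM ltac:(lra).
  have := k1 (Num.min s t) t M0 tM ltac:(lra).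
  rewrite /e in ls kt; lra.
Qed.

Lemma lhalf_cst (c : R) : lhalf (fun=> c).
Proof.
split=> // [r x r01 xc|x cx]; first by exists (r / 2) => //; lra.
by exists 1 => //; lra.
Qed.

Lemma lhalfZ (c : R) l : 0 <= c -> lhalf l -> lhalf (fun r => c * l r).
Proof.
rewrite le_eqVlt => /orP[/eqP <- _|c0 [l1 l2 l3]].
  by under eq_fun do rewrite mul0r; exact: lhalf_cst.
split=> [r s r0 rs s1|r x r01|x].
- by rewrite ler_pM2l //; exact: l1.
- rewrite -ltr_pdivrMl // => /(l2 _ _ r01)[s sr ls]; exists s => //.
  by rewrite -ltr_pdivrMl.
- rewrite -ltr_pdivlMl // => /l3[s sr ls]; exists s => //.
  by rewrite -ltr_pdivlMl.
Qed.

(** A third of the gap goes to each passage between [l] and the approximant, and a third remains to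
    apply the property of the approximant. *)
Lemma lhalf_unif l :
  (forall e, 0 < e -> exists2 k, lhalf k & forall r, 0 <= r <= 1 -> `|l r - k r| <= e) ->
  lhalf l.
Proof.
move=> H; split.
- move=> r s r0 rs s1; apply/ler_addgt0Pr => e e0.
  have [k [k1 _ _] lk] := H (e / 2) ltac:(lra).
  have := k1 r s r0 rs s1.
  have := lk r ltac:(lra); have := lk s ltac:(lra).
  rewrite !ler_norml; lra.
- move=> r x r01 xl; pose e := (l r - x) / 3.
  have [|k [k1 k2 _] lk] := H e; first by rewrite /e; lra.
  have lkr := lk r ltac:(lra).
  have [||s sr ks] := k2 r (x + e); first by [].
    by move: lkr; rewrite /e ler_norml; lra.
  exists s => //; move: (lk s ltac:(lra)); rewrite ler_norml; lra.
- move=> x xl; pose e := (x - l 0) / 3.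
  have [|k [k1 _ k3] lk] := H e; first by rewrite /e; lra.
  have lk0 := lk 0 ltac:(lra).
  have [|s sr ks] := k3 (x - e).
    by move: lk0; rewrite /e ler_norml; lra.
  exists s => //; move: (lk s ltac:(lra)); rewrite ler_norml; lra.
Qed.

Lemma closure_real (S : set R) x :
  closure S x <-> forall e, 0 < e -> exists2 y, S y & `|x - y| < e.
Proof.
split=> [cS e e0|H B].
  by have [y [Sy xy]] := cS _ (nbhsx_ballx x e e0); exists y.
by case/nbhs_ballP => e /= e0 eB; have [y Sy xy] := H e e0; exists y; split=> //; exact: eB.
Qed.

Lemma inf_eq (E : set R) a : lbound E a ->
  (forall x, a < x -> exists2 y, E y & y < x) -> inf E = a.
Proof.
move=> lb H; have [y Ey _] := H (a + 1) ltac:(lra).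
have E0 : E !=set0 by exists y.
apply/eqP; rewrite eq_le lb_le_inf // andbT.
apply/ler_addgt0Pr => e e0; have [z Ez zx] := H (a + e) ltac:(lra).
by apply: le_trans (ge_inf _ Ez) (ltW zx); exists a.
Qed.

Lemma normr_oppB (x y : R) : `|- x - - y| = `|x - y|.
Proof. by rewrite -opprD normrN. Qed.

(** Reflection exchanges lower and upper ends up to sign, so facts about upper ends follow from
    those about lower ends. *)
Definition mirror u : R -> R := fun x => u (- x).

Lemma mirrorK u : mirror (mirror u) = u.
Proof. by apply/funext => x; rewrite /mirror opprK. Qed.

Lemma level_mirror u r : level (mirror u) r = -%R @` level u r.
Proof.
rewrite /level; case: ifP => _; apply/seteqP; split=> x.
- move=> /closure_real H; exists (- x); last by rewrite opprK.
  apply/closure_real => e /H[y /= uy xy]; exists (- y) => //.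
  by rewrite normr_oppB.
- move=> [y /closure_real H <-]; apply/closure_real => e /H[z uz yz].
  by exists (- z); rewrite ?normr_oppB // /mirror /= opprK.
- by move=> rx; exists (- x); rewrite ?opprK.
- by move=> [y ry <-]; rewrite /mirror /= opprK.
Qed.

Lemma lower_mirror u r : lower (mirror u) r = - upper u r.
Proof.
rewrite /lower /inf level_mirror; congr (- sup _).
by apply/seteqP; split=> [x [_ [y H <-] <-]|x H]; rewrite ?opprK //; exists (- x); [exists x|rewrite opprK].
Qed.

Lemma mirror_support u : fuzzy_support (mirror u) = -%R @` fuzzy_support u.
Proof. by have := level_mirror u 0; rewrite /level eqxx. Qed.

Lemma is_fuzzy_mirror u : is_fuzzy u -> is_fuzzy (mirror u).
Proof.
move=> [u01 [x0 ux0] uc us uK]; split=> [x|||x e e0|]; first exact: u01.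
- by exists (- x0); rewrite /mirror opprK.
- move=> x y t t01; rewrite /mirror opprD -!mulrN; exact: uc.
- have [d d0 H] := us (- x) e e0; exists d => // y xy; apply: H.
  by rewrite normr_oppB.
- rewrite mirror_support; apply: continuous_compact => //.
  by apply: continuous_subspaceT => x; exact: opp_continuous.
Qed.

Lemma represents_mirror l m u :
  represents l m u -> represents (\- m) (\- l) (mirror u).
Proof.
move=> [u01 H]; split=> [x|r x r01]; first exact: u01.
by rewrite H //=; split; lra.
Qed.

Lemma level_pair_mirror l m : level_pair l m -> level_pair (\- m) (\- l).
Proof.
move=> [hl hm lm]; split=> //=; last by rewrite lerN2.
suff -> : (\- \- l) = l by [].
by apply/funext => x /=; rewrite opprK.
Qed.

(** * From level pairs to fuzzy numbers *)

Section RepresentedIsFuzzy.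
Variables (l m u : R -> R).
Hypotheses (lm : level_pair l m) (ru : represents l m u).

Let l_le r : 0 <= r <= 1 -> l 0 <= l r <= l 1.
Proof. by move=> r01; have [[+ _ _] _ _] := lm; move=> H; rewrite !H //; lra. Qed.

Let m_ge r : 0 <= r <= 1 -> m 1 <= m r <= m 0.
Proof.
move=> r01; have [_ [+ _ _] _] := lm; move=> /= H.
have := H 0 r; have := H r 1; rewrite !lerN2; case/andP: r01 => r0 r1.
by move=> /(_ r0 r1 (lexx _)) -> /(_ (lexx _) r0 r1) ->.
Qed.

Let pos_between x : 0 < u x -> l 0 <= x <= m 0.
Proof.
move=> ux; have [u01 H] := ru; have := u01 x => ux1.
have r01 : 0 < u x <= 1 by lra.
have /H := lexx (u x) => /(_ r01).
have := l_le (r := u x); have := m_ge (r := u x); lra.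
Qed.

Let support_between : fuzzy_support u `<=` `[l 0, m 0].
Proof.
move=> x /closure_real H; rewrite /= in_itv /=; apply/andP; split.
  apply/ler_addgt0Pr => e /H[y /pos_between]; rewrite ltr_norml; lra.
apply/ler_addgt0Pr => e /H[y /pos_between]; rewrite ltr_norml; lra.
Qed.

(** For [r > 0] the level is the segment [[l r, m r]]. At 0 the points [l s] with [s > 0] belong to
    the support, and right continuity brings them arbitrarily close to [l 0]. *)
Lemma represented_lower r : 0 <= r <= 1 -> lower u r = l r.
Proof.
move=> r01; have [u01 H] := ru; have [[l1 l2 l3] _ l1m1] := lm.
have lmr s : 0 <= s <= 1 -> l s <= m s.
  by move=> s01; have := l_le s01; have := m_ge s01; lra.
rewrite /lower /level; case: eqP => [->|/eqP r0]; apply: inf_eq.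
- by move=> x /support_between; rewrite /= in_itv /=; lra.
- move=> x /l3[s s01 ls]; exists (l s) => //.
  apply/closure_real => e e0; exists (l s); last by rewrite subrr normr0.
  have /(H _ (l s)) [_ Hs] := s01; rewrite /=.
  apply: lt_le_trans (Hs _); first by case/andP: s01.
  by rewrite lexx lmr //; lra.
- by move=> x /= /H; lra.
- move=> x lx; exists (l r) => //=; apply/H; first lra.
  by rewrite lexx lmr.
Qed.

Lemma represented_fuzzy : is_fuzzy u.
Proof.
have [u01 H] := ru; have [_ _ l1m1] := lm; split=> //.
- exists (l 1); apply/eqP; rewrite eq_le; have /andP[_ ->] := u01 (l 1).
  by rewrite H ?lexx //; lra.
- move=> x y t t01; set r := Num.min _ _.
  have rx : r <= u x by rewrite ge_min lexx.
  have ry : r <= u y by rewrite ge_min lexx orbT.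
  have [r0|r0] := leP r 0; first by apply: le_trans r0 _; case/andP: (u01 (t * x + (1 - t) * y)).
  have r01 : 0 < r <= 1 by rewrite r0; have := u01 x; lra.
  move: rx ry; rewrite !H // => /andP[? ?] /andP[? ?]; apply/andP; split; nra.
- move=> x e e0; have := u01 x => ux.
  (* No value exceeds 1, so any radius works in the first case. Otherwise [x] lies outside the
     segment of level [u x + e], and its distance to the end it lies beyond is the radius. *)
  have [e1|e1] := ltP 1 (u x + e).
    by exists 1 => // y _; have := u01 y; lra.
  have r01 : 0 < u x + e <= 1 by lra.
  have : ~~ (l (u x + e) <= x <= m (u x + e)).
    by apply/negP => /(H _ x r01); lra.
  rewrite negb_and -!ltNge => /orP[lt|lt].
    exists (l (u x + e) - x); first by rewrite subr_gt0.
    move=> y; rewrite ltr_norml => xy; rewrite ltNge; apply/negP => /(H _ y r01); lra.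
  exists (x - m (u x + e)); first by rewrite subr_gt0.
  move=> y; rewrite ltr_norml => xy; rewrite ltNge; apply/negP => /(H _ y r01); lra.
- exact: subclosed_compact (@closed_closure _ _) (@segment_compact _ _ _) support_between.
Qed.

End RepresentedIsFuzzy.

Lemma represented_upper l m u : level_pair l m -> represents l m u ->
  forall r, 0 <= r <= 1 -> upper u r = m r.
Proof.
move=> /level_pair_mirror lm /represents_mirror ru r r01; apply: oppr_inj.
by rewrite -lower_mirror (represented_lower lm ru).
Qed.

(** [u x] is the supremum of the levels whose segment contains [x]; adjoining 0 gives the value 0 to
    points of no segment. From [r <= u x] one gets [x] in the segments of all levels [s < r] only,
    and left continuity of the ends extends this to [r]. *)
Lemma level_pair_represented l m : level_pair l m -> exists u, represents l m u.
Proof.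
move=> [[l1 l2 l3] [m1 m2 m3] lm1].
pose E x := [set r | r = 0 \/ 0 < r <= 1 /\ l r <= x <= m r].
have E0 x : E x 0 by left.
have Eub x : ubound (E x) 1 by move=> r [->|]; lra.
have Ebd x : has_ubound (E x) by exists 1.
exists (fun x => sup (E x)); split=> [x|r x r01].
  by rewrite ub_le_sup //= ge_sup //; exists 0.
split=> [rs|H]; last by apply: ub_le_sup => //; right.
have key s : 0 < s < r -> l s <= x <= m s.
  move=> sr; have [||t Et st] := @sup_gt _ (E x) s; [by exists 0|lra|].
  case: Et => [t0|[t01 /andP[lt mt]]]; first lra.
  have := l1 s t ltac:(lra) ltac:(lra) ltac:(lra).
  have := m1 s t ltac:(lra) ltac:(lra) ltac:(lra) => /=; lra.
apply/andP; split; rewrite leNgt; apply/negP => lt.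
  by have [s /key + ?] := l2 r x r01 lt; lra.
have [|s /key/andP[_ xm] /=] := m2 r (- x) r01; first by rewrite /= ltrN2.
by rewrite ltrN2 ltNge xm.
Qed.

(** * From fuzzy numbers to level pairs *)

Section Fuzzy.
Variable u : R -> R.
Hypothesis fu : is_fuzzy u.

Let supp_bounded : exists B, forall x, fuzzy_support u x -> `|x| <= B.
Proof.
have [_ _ _ _ /compact_bounded [M [_ HM]]] := fu.
by exists (M + 1) => x ux; apply: (HM (M + 1)) => //; rewrite ltrDl.
Qed.

Let level_supp r : 0 <= r -> level u r `<=` fuzzy_support u.
Proof.
move=> r0; rewrite /level; case: eqP => [_ //|/eqP rN0].
have {}r0 : 0 < r by rewrite lt_neqAle eq_sym rN0.
by move=> x /= rx; apply: subset_closure; exact: lt_le_trans rx.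
Qed.

Let level_top r : 0 <= r <= 1 -> exists x, level u r x.
Proof.
move=> r01; have [_ [x ux] _ _ _] := fu; exists x.
rewrite /level; case: eqP => _; last by rewrite /= ux; lra.
by apply: subset_closure; rewrite /= ux.
Qed.

Let level_lb r : 0 <= r -> has_lbound (level u r).
Proof.
move=> r0; have [B HB] := supp_bounded; exists (- B) => x /(level_supp r0)/HB.
by rewrite ler_norml => /andP[].
Qed.

Lemma lower_le r x : 0 < r <= 1 -> r <= u x -> lower u r <= x.
Proof.
move=> r01 rx; apply: ge_inf; first by apply: level_lb; lra.
by rewrite /level; case: eqP => // r0; lra.
Qed.

(** The infimum of a level is attained by upper semicontinuity: a value below [r] there would
    persist nearby, where the level has points. *)
Lemma lower_mem r : 0 < r <= 1 -> r <= u (lower u r).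
Proof.
move=> r01; rewrite leNgt; apply/negP => lt.
have [_ _ _ us _] := fu.
have [d d0 Hd] := us (lower u r) (r - u (lower u r)) ltac:(lra).
have [|y ry yd] := @inf_adherent _ (level u r) d d0.
  by split; [apply: level_top; lra|apply: level_lb; lra].
have {}ry : r <= u y by move: ry; rewrite /level; case: eqP => // r0; lra.
have := lower_le r01 ry => ly.
have := Hd y; rewrite ger0_norm ?subr_ge0 //.
have yd' : y - lower u r < d by rewrite ltrBlDl.
by move=> /(_ yd'); lra.
Qed.

Lemma lhalf_lower : lhalf (lower u).
Proof.
have mono r s : 0 <= r -> r <= s -> s <= 1 -> lower u r <= lower u s.
  move=> r0 rs s1; have [s0|s0] := eqVneq s 0; first by have -> : r = s by lra.
  apply: ge_inf; first exact: level_lb.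
  have := lower_mem (r := s) ltac:(lra) => H; rewrite /level; case: eqP => _ /=; last lra.
  by apply: subset_closure => /=; lra.
split=> // [r x r01 xl|x].
  have u01 := let: And5 H _ _ _ _ := fu in H.
  have ux : u x < r by rewrite ltNge; apply/negP => /(lower_le r01); lra.
  (* Any level strictly between [u x] and [r] works. If [lower u s <= x], then [x] lies between two
     points where [u >= s], and convexity gives [u x >= s], although [s > u x]. *)
  exists ((u x + r) / 2); first by have := u01 x; lra.
  rewrite ltNge; apply/negP => ls.
  pose s := (u x + r) / 2; have s01 : 0 < s <= 1 by have := u01 x; rewrite /s; lra.
  have a1 := lower_mem s01; have a2 := lower_mem r01.
  pose t := (lower u r - x) / (lower u r - lower u s).
  have dpos : 0 < lower u r - lower u s by rewrite /s; lra.
  have t01 : 0 <= t <= 1 by rewrite divr_ge0 ?ler_pdivrMr //= /s; lra.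
  have [_ _ uc _ _] := fu.
  have := uc (lower u s) (lower u r) t t01.
  have -> : t * lower u s + (1 - t) * lower u r = x.
    have tE : t * (lower u r - lower u s) = lower u r - x by rewrite divfK // gt_eqF.
    lra.
  by rewrite ge_min; move: a1 a2; rewrite {1}/s; lra.
(* Level 0 is a closure: a support point below [x] has points [z] with [u z > 0] close to it, and
   [u z] is the level sought. *)
move=> lx; have [|y uy yx] := @inf_lt _ (level u 0) x _ lx.
  by apply: level_top; lra.
move: uy; rewrite /level eqxx => /closure_real /(_ (x - y) ltac:(lra)) [z /= uz yz].
have u01 := let: And5 H _ _ _ _ := fu in H.
have r01 : 0 < u z <= 1 by have := u01 z; lra.
exists (u z) => //; apply: le_lt_trans (lower_le r01 (lexx _)) _.
by move: yz; rewrite ltr_norml; lra.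
Qed.

End Fuzzy.

Lemma upper_ge u : is_fuzzy u -> forall r x, 0 < r <= 1 -> r <= u x -> x <= upper u r.
Proof.
move=> fu r x r01 rx; have := lower_le (is_fuzzy_mirror fu) (x := - x) r01.
by rewrite /mirror opprK lower_mirror lerN2; exact.
Qed.

Lemma upper_mem u : is_fuzzy u -> forall r, 0 < r <= 1 -> r <= u (upper u r).
Proof.
move=> fu r r01; have := lower_mem (is_fuzzy_mirror fu) r01.
by rewrite lower_mirror /mirror opprK.
Qed.

Lemma fuzzy_level_pair u : is_fuzzy u -> level_pair (lower u) (upper u).
Proof.
move=> fu; split; first exact: lhalf_lower.
  have -> : \- upper u = lower (mirror u) by apply/funext => r /=; rewrite lower_mirror.
  exact/lhalf_lower/is_fuzzy_mirror.
by apply: upper_ge => //; [lra|apply: lower_mem => //; lra].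
Qed.

(** Both ends of a level belong to it, and convexity fills the segment between them. Coinciding ends
    are separated off because the convex coefficient divides by their difference. *)
Lemma fuzzy_represents u : is_fuzzy u -> represents (lower u) (upper u) u.
Proof.
move=> fu; have [u01 _ uc _ _] := fu; split=> // r x r01; split=> [rx|/andP[lx xu]].
  by rewrite lower_le // upper_ge.
have a1 := lower_mem fu r01; have a2 := upper_mem fu r01.
have [E|E] := eqVneq (lower u r) (upper u r).
  by have <- : lower u r = x by lra.
have dpos : 0 < upper u r - lower u r by lra.
pose t := (upper u r - x) / (upper u r - lower u r).
have t01 : 0 <= t <= 1 by rewrite divr_ge0 ?ler_pdivrMr //=; lra.
have := uc (lower u r) (upper u r) t t01.
have -> : t * lower u r + (1 - t) * upper u r = x.
  have tE : t * (upper u r - lower u r) = upper u r - x by rewrite divfK // gt_eqF.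
  lra.
by apply: le_trans; rewrite le_min a1.
Qed.

Lemma represents_inj l m u v : represents l m u -> represents l m v -> u = v.
Proof.
suff H u' v' x : represents l m u' -> represents l m v' -> u' x <= v' x.
  by move=> ru rv; apply/funext => x; apply/eqP; rewrite eq_le !H.
move=> [u01 ru] [v01 rv]; have [u0|u0] := leP (u' x) 0.
  by apply: le_trans u0 _; case/andP: (v01 x).
have r01 : 0 < u' x <= 1 by rewrite u0; case/andP: (u01 x).
by apply/(rv _ _ r01)/(ru _ _ r01).
Qed.

(** Reduces the algebra of fuzzy numbers to identities between real functions of the level. *)
Lemma fuzzy_ext u v : is_fuzzy u -> is_fuzzy v ->
  (forall r, 0 <= r <= 1 -> lower u r = lower v r /\ upper u r = upper v r) -> u = v.
Proof.
move=> fu fv E; apply: (@represents_inj (lower u) (upper u)); first exact: fuzzy_represents.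
have [v01 H] := fuzzy_represents fv; split=> // r x r01.
by have [|-> ->] := E r; [lra|exact: H].
Qed.

(** * Zero, sums and nonnegative multiples in terms of levels *)

Lemma fzero_represents : represents (fun=> 0) (fun=> 0) (@fzero R).
Proof.
split=> [x|r x r01]; rewrite /fzero; first by case: ifP; lra.
by case: eqP => [->|x0]; split; [lra|lra|lra|move=> ?; case: x0; lra].
Qed.

Lemma level_pair0 : level_pair (fun=> 0) (fun=> 0 : R).
Proof. by split; rewrite //; [exact: lhalf_cst|exact: (lhalf_cst (- 0))]. Qed.

Lemma fuzzy0 : is_fuzzy (@fzero R).
Proof. exact: represented_fuzzy level_pair0 fzero_represents. Qed.

Lemma lower0 r : 0 <= r <= 1 -> lower (@fzero R) r = 0.
Proof. exact: represented_lower level_pair0 fzero_represents r. Qed.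

Lemma upper0 r : 0 <= r <= 1 -> upper (@fzero R) r = 0.
Proof. exact: represented_upper level_pair0 fzero_represents r. Qed.

Lemma level_pairD l m k n : level_pair l m -> level_pair k n ->
  level_pair (l \+ k) (m \+ n).
Proof.
move=> [l1 m1 lm] [k1 n1 kn]; split; [exact: lhalfD| |exact: lerD].
have -> : \- (m \+ n) = (\- m) \+ (\- n) by apply/funext => r /=; rewrite opprD.
exact: lhalfD.
Qed.

Lemma level_pairZ c l m : 0 <= c -> level_pair l m ->
  level_pair (fun r => c * l r) (fun r => c * m r).
Proof.
move=> c0 [l1 m1 lm]; split; [exact: lhalfZ| |exact: ler_wpM2l].
have -> : \- (fun r => c * m r) = (fun r => c * (\- m) r) by apply/funext => r /=; rewrite mulrN.
exact: lhalfZ.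
Qed.

(** The levels of the sup-min convolution are the Minkowski sums of the levels. A supremum of at
    least [r] yields decompositions of [x] only at levels [s < r], and left continuity passes to
    [r]. Conversely, [x] is split by taking the upper end of [v] if [x] is large enough for this,
    and the lower end of [u] otherwise. *)
Lemma fadd_represents u v : is_fuzzy u -> is_fuzzy v ->
  represents (lower u \+ lower v) (upper u \+ upper v) (fadd u v).
Proof.
move=> fu fv.
have [[l1 l2 _] [m1 m2 _] lm] := level_pairD (fuzzy_level_pair fu) (fuzzy_level_pair fv).
have [u01 Hu] := fuzzy_represents fu; have [v01 Hv] := fuzzy_represents fv.
pose E x := range (fun y => Num.min (u y) (v (x - y))).
have E0 x : E x !=set0 by exists (Num.min (u 0) (v (x - 0))); exists 0.
have Eub x : ubound (E x) 1.
  by move=> _ [y _ <-]; rewrite ge_min; case/andP: (u01 y) => _ ->.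
have Ebd x : has_ubound (E x) by exists 1.
split=> [x|r x r01].
  apply/andP; split; last exact: (ge_sup (E0 x) (Eub x)).
  apply: (@le_trans _ _ (Num.min (u 0) (v (x - 0)))); last by apply: (ub_le_sup (Ebd x)); exists 0.
  by rewrite le_min; case/andP: (u01 0) => ->; case/andP: (v01 (x - 0)) => ->.
split=> [rs|/= /andP[lx xm]].
  have key s : 0 < s < r -> lower u s + lower v s <= x <= upper u s + upper v s.
    move=> sr; have [|_ [y _ <-]] := @sup_gt _ (E x) s (E0 x).
      by apply: lt_le_trans rs; lra.
    rewrite lt_min => /andP[/ltW su /ltW sv].
    move: su sv; rewrite Hu ?Hv; lra.
  apply/andP; split; rewrite leNgt; apply/negP => lt.
    by have [s /key/andP[ls _] /=] := l2 r x r01 lt; rewrite ltNge ls.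
  have [|s /key/andP[_ xm] /=] := m2 r (- x) r01; first by rewrite /= ltrN2.
  by rewrite ltrN2 ltNge xm.
have [y /andP[ly yu] /andP[lxy xyu]] : exists2 y, lower u r <= y <= upper u r & lower v r <= x - y <= upper v r.
  have ru := upper_ge fu r01 (lower_mem fu r01).
  have rv := upper_ge fv r01 (lower_mem fv r01).
  have [h|h] := leP (lower u r + upper v r) x.
    by exists (x - upper v r); lra.
  by exists (lower u r); lra.
apply: (@le_trans _ _ (Num.min (u y) (v (x - y)))); last by apply: (ub_le_sup (Ebd x)); exists y.
by rewrite le_min; apply/andP; split; [apply/Hu|apply/Hv] => //; apply/andP.
Qed.

Lemma fsmul_represents c u : 0 <= c -> is_fuzzy u ->
  represents (fun r => c * lower u r) (fun r => c * upper u r) (fsmul c u).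
Proof.
rewrite le_eqVlt => /orP[/eqP <- _|c0 fu].
  rewrite /fsmul eqxx; have [? H] := fzero_represents; split=> // r x r01.
  by rewrite !mul0r; exact: H.
have [u01 Hu] := fuzzy_represents fu; rewrite /fsmul gt_eqF //.
split=> [x|r x r01]; first exact: u01.
by rewrite Hu // ler_pdivlMr // ler_pdivrMr // ![c * _]mulrC.
Qed.

Lemma fuzzyD u v : is_fuzzy u -> is_fuzzy v -> is_fuzzy (fadd u v).
Proof.
move=> fu fv; exact: represented_fuzzy
  (level_pairD (fuzzy_level_pair fu) (fuzzy_level_pair fv)) (fadd_represents fu fv).
Qed.

Lemma fuzzyZ c u : 0 <= c -> is_fuzzy u -> is_fuzzy (fsmul c u).
Proof.
move=> c0 fu; exact: represented_fuzzy
  (level_pairZ c0 (fuzzy_level_pair fu)) (fsmul_represents c0 fu).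
Qed.

Lemma lowerD u v r : is_fuzzy u -> is_fuzzy v -> 0 <= r <= 1 ->
  lower (fadd u v) r = lower u r + lower v r.
Proof.
move=> fu fv; exact: represented_lower
  (level_pairD (fuzzy_level_pair fu) (fuzzy_level_pair fv)) (fadd_represents fu fv) r.
Qed.

Lemma upperD u v r : is_fuzzy u -> is_fuzzy v -> 0 <= r <= 1 ->
  upper (fadd u v) r = upper u r + upper v r.
Proof.
move=> fu fv; exact: represented_upper
  (level_pairD (fuzzy_level_pair fu) (fuzzy_level_pair fv)) (fadd_represents fu fv) r.
Qed.

Lemma lowerZ c u r : 0 <= c -> is_fuzzy u -> 0 <= r <= 1 ->
  lower (fsmul c u) r = c * lower u r.
Proof.
move=> c0 fu; exact: represented_lower
  (level_pairZ c0 (fuzzy_level_pair fu)) (fsmul_represents c0 fu) r.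
Qed.

Lemma upperZ c u r : 0 <= c -> is_fuzzy u -> 0 <= r <= 1 ->
  upper (fsmul c u) r = c * upper u r.
Proof.
move=> c0 fu; exact: represented_upper
  (level_pairZ c0 (fuzzy_level_pair fu)) (fsmul_represents c0 fu) r.
Qed.

End FuzzyLevels.

(** * The metric on fuzzy numbers *)

Section FuzzyMetric.
Variable R : realType.
Implicit Types (u v w : R -> R).

Lemma subrDl (x y z : R) : (x + y) - (x + z) = y - z.
Proof. by ring. Qed.

Lemma subrDD (x y z t : R) : (x + y) - (z + t) = (x - z) + (y - t).
Proof. by ring. Qed.

Lemma Dist_le u v c : (forall r, 0 <= r <= 1 ->
    `|lower u r - lower v r| <= c /\ `|upper u r - upper v r| <= c) ->
  Dist u v <= c.
Proof.
move=> H; apply: ge_sup.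
  by exists (Num.max `|lower u 0 - lower v 0| `|upper u 0 - upper v 0|); exists 0 => //=; lra.
by move=> _ [r r01 <-]; have [h1 h2] := H r r01; rewrite ge_max h1.
Qed.

Lemma fuzzy_level_bounds u r : is_fuzzy u -> 0 <= r <= 1 ->
  lower u 0 <= lower u r <= upper u 0 /\ lower u 0 <= upper u r <= upper u 0.
Proof.
move=> /fuzzy_level_pair[[l _ _] [m _ _] lm] /andP[r0 r1].
have := l 0 r (lexx _) r0 r1; have := l r 1 r0 r1 (lexx _).
have := m 0 r (lexx _) r0 r1; have := m r 1 r0 r1 (lexx _).
by rewrite /= => *; split; lra.
Qed.

(** A real [sup] bounds its elements only if the set is bounded: all level ends lie between the ends
    of level 0. *)
Lemma Dist_ge u v r : is_fuzzy u -> is_fuzzy v -> 0 <= r <= 1 ->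
  `|lower u r - lower v r| <= Dist u v /\ `|upper u r - upper v r| <= Dist u v.
Proof.
move=> fu fv r01; pose E := [set Num.max `|lower u r - lower v r| `|upper u r - upper v r| | r in [set r | 0 <= r <= 1]].
have Eub : has_ubound E.
  exists (`|lower u 0| + `|upper u 0| + `|lower v 0| + `|upper v 0|) => _ [s s01 <-].
  have [] := fuzzy_level_bounds fu s01; have [] := fuzzy_level_bounds fv s01.
  rewrite ge_max !ler_norml.
  have := ler_norm (upper u 0); have := ler_norm (upper v 0).
  have := ler_norm (- lower u 0); have := ler_norm (- lower v 0).
  have := ler_norm (- upper u 0); have := ler_norm (- upper v 0).
  have := ler_norm (lower u 0); have := ler_norm (lower v 0).
  by rewrite !normrN; lra.
have H : Num.max `|lower u r - lower v r| `|upper u r - upper v r| <= Dist u v.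
  by apply: ub_le_sup => //; exists r.
by split; apply: le_trans H; rewrite le_max lexx ?orbT.
Qed.

Lemma Dist_ge0 u v : is_fuzzy u -> is_fuzzy v -> 0 <= Dist u v.
Proof.
by move=> fu fv; have [|+ _] := Dist_ge (r := 0) fu fv; [lra|exact: le_trans].
Qed.

Lemma Dist_refl u : is_fuzzy u -> Dist u u = 0.
Proof.
move=> fu; apply/eqP; rewrite eq_le Dist_ge0 // andbT.
by apply: Dist_le => r _; rewrite !subrr normr0.
Qed.

Lemma Dist_sym u v : Dist u v = Dist v u.
Proof.
rewrite /Dist; congr sup; apply/seteqP; split=> _ [r r01 <-]; exists r => //.
  by rewrite distrC (distrC (upper v r)).
by rewrite distrC (distrC (upper u r)).
Qed.

Lemma Dist_tri w u v : is_fuzzy u -> is_fuzzy w -> is_fuzzy v ->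
  Dist u v <= Dist u w + Dist w v.
Proof.
move=> fu fw fv; apply: Dist_le => r r01.
have [a1 a2] := Dist_ge fu fw r01; have [b1 b2] := Dist_ge fw fv r01.
by split; apply: le_trans (ler_distD _ _ _) _; apply: lerD; eassumption.
Qed.

Lemma Dist_eq0 u v : is_fuzzy u -> is_fuzzy v -> Dist u v <= 0 -> u = v.
Proof.
move=> fu fv D0; apply: fuzzy_ext => // r r01.
have [a1 a2] := Dist_ge fu fv r01.
by split; apply/eqP; rewrite -subr_eq0 -normr_le0 (le_trans _ D0).
Qed.

Lemma DistD u v u' v' : is_fuzzy u -> is_fuzzy v -> is_fuzzy u' -> is_fuzzy v' ->
  Dist (fadd u v) (fadd u' v') <= Dist u u' + Dist v v'.
Proof.
move=> fu fv fu' fv'; apply: Dist_le => r r01.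
have [a1 a2] := Dist_ge fu fu' r01; have [b1 b2] := Dist_ge fv fv' r01.
rewrite !lowerD // !upperD //.
by split; rewrite subrDD (le_trans (ler_normD _ _)) // lerD.
Qed.

Lemma DistDl w u v : is_fuzzy w -> is_fuzzy u -> is_fuzzy v ->
  Dist (fadd w u) (fadd w v) = Dist u v.
Proof.
move=> fw fu fv; apply/eqP; rewrite eq_le; apply/andP; split.
  by rewrite (le_trans (DistD _ _ _ _)) // Dist_refl // add0r.
apply: Dist_le => r r01.
have := Dist_ge (fuzzyD fw fu) (fuzzyD fw fv) r01.
by rewrite !lowerD // !upperD // !subrDl.
Qed.

Lemma Dist_addl u v : is_fuzzy u -> is_fuzzy v -> Dist (fadd u v) u = Dist (@fzero R) v.
Proof.
move=> fu fv; have f0 := @fuzzy0 R.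
have {2}-> : u = fadd u (@fzero R).
  apply: fuzzy_ext => // [|r r01]; first exact: fuzzyD.
  by rewrite lowerD // upperD // lower0 // upper0 // !addr0.
by rewrite DistDl // Dist_sym.
Qed.

Lemma DistZ c u v : 0 <= c -> is_fuzzy u -> is_fuzzy v ->
  Dist (fsmul c u) (fsmul c v) = c * Dist u v.
Proof.
move=> c0 fu fv; apply/eqP; rewrite eq_le; apply/andP; split.
  apply: Dist_le => r r01; have [a1 a2] := Dist_ge fu fv r01.
  by rewrite !lowerZ // !upperZ // -!mulrBr !normrM ger0_norm // !ler_wpM2l.
have [cE|cN0] := eqVneq c 0.
  by rewrite {1}cE mul0r; apply: Dist_ge0; exact: fuzzyZ.
have cpos : 0 < c by rewrite lt_neqAle eq_sym cN0.
rewrite mulrC -ler_pdivlMr //; apply: Dist_le => r r01.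
have := Dist_ge (fuzzyZ c0 fu) (fuzzyZ c0 fv) r01.
by rewrite !lowerZ // !upperZ // -!mulrBr !normrM ger0_norm // !ler_pdivlMr // ![_ * c]mulrC.
Qed.

Lemma fsmul0 c : 0 <= c -> fsmul c (@fzero R) = @fzero R.
Proof.
move=> c0; have f0 := @fuzzy0 R; apply: fuzzy_ext => // [|r r01]; first exact: fuzzyZ.
by rewrite lowerZ // upperZ // lower0 // upper0 // mulr0.
Qed.

Lemma Dist0Z c u : 0 <= c -> is_fuzzy u ->
  Dist (@fzero R) (fsmul c u) = c * Dist (@fzero R) u.
Proof. by move=> c0 fu; rewrite -{1}(fsmul0 c0) DistZ //; exact: fuzzy0. Qed.

Lemma fadd0 u : is_fuzzy u -> fadd u (@fzero R) = u.
Proof.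
move=> fu; have f0 := @fuzzy0 R; apply: fuzzy_ext => // [|r r01]; first exact: fuzzyD.
by rewrite lowerD // upperD // lower0 // upper0 // !addr0.
Qed.

Lemma faddACA u v u' v' : is_fuzzy u -> is_fuzzy v -> is_fuzzy u' -> is_fuzzy v' ->
  fadd (fadd u v) (fadd u' v') = fadd (fadd u u') (fadd v v').
Proof.
move=> fu fv fu' fv'.
have fuv := fuzzyD fu fv; have fuv' := fuzzyD fu' fv'.
have fuu := fuzzyD fu fu'; have fvv := fuzzyD fv fv'.
apply: fuzzy_ext => [||r r01]; [exact: fuzzyD|exact: fuzzyD|].
rewrite (lowerD fuv) // (upperD fuv) // (lowerD fuu) // (upperD fuu) //.
by rewrite !lowerD // !upperD //; split; exact: addrACA.
Qed.

Lemma faddA u v w : is_fuzzy u -> is_fuzzy v -> is_fuzzy w ->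
  fadd (fadd u v) w = fadd u (fadd v w).
Proof.
move=> fu fv fw; have fuv := fuzzyD fu fv; have fvw := fuzzyD fv fw.
apply: fuzzy_ext => [||r r01]; [exact: fuzzyD|exact: fuzzyD|].
rewrite (lowerD fuv) // (upperD fuv) // (lowerD fu fvw) // (upperD fu fvw) //.
by rewrite !lowerD // !upperD //; split; rewrite -addrA.
Qed.

Lemma fsmulDr c u v : 0 <= c -> is_fuzzy u -> is_fuzzy v ->
  fsmul c (fadd u v) = fadd (fsmul c u) (fsmul c v).
Proof.
move=> c0 fu fv; have fuv := fuzzyD fu fv.
have fcu := fuzzyZ c0 fu; have fcv := fuzzyZ c0 fv.
apply: fuzzy_ext => [||r r01]; [exact: fuzzyZ|exact: fuzzyD|].
rewrite (lowerZ c0 fuv) // (upperZ c0 fuv) // (lowerD fcu) // (upperD fcu) //.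
by rewrite lowerD // upperD // !lowerZ // !upperZ //; split; rewrite mulrDr.
Qed.

(** Signs matter: for [b = - a] the left side is zero, while on the right a nondegenerate level
    stays a nondegenerate symmetric interval. *)
Lemma fsmulDl a b u : 0 <= a -> 0 <= b -> is_fuzzy u ->
  fsmul (a + b) u = fadd (fsmul a u) (fsmul b u).
Proof.
move=> a0 b0 fu; have fa := fuzzyZ a0 fu; have fb := fuzzyZ b0 fu.
have ab0 := addr_ge0 a0 b0.
apply: fuzzy_ext => [||r r01]; [exact: fuzzyZ|exact: fuzzyD|].
rewrite (lowerD fa) // (upperD fa) //.
by rewrite !lowerZ // !upperZ //; split; rewrite mulrDl.
Qed.

Lemma fsmulA a b u : 0 <= a -> 0 <= b -> is_fuzzy u ->
  fsmul a (fsmul b u) = fsmul (a * b) u.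
Proof.
move=> a0 b0 fu; have fb := fuzzyZ b0 fu; have ab0 := mulr_ge0 a0 b0.
apply: fuzzy_ext => [||r r01]; [exact: fuzzyZ|exact: fuzzyZ|].
rewrite (lowerZ a0 fb) // (upperZ a0 fb) // !lowerZ // !upperZ //.
by split; rewrite mulrA.
Qed.

Lemma fsmul1 u : is_fuzzy u -> fsmul 1 u = u.
Proof.
move=> fu; apply: fuzzy_ext => // [|r r01]; first exact: fuzzyZ.
by rewrite lowerZ // upperZ // !mul1r.
Qed.

(** * Completeness of the fuzzy numbers *)

(** The limit is obtained as the supremum of the eventual lower bounds, that is, the lower limit. *)
Lemma real_cauchy (a : nat -> R) :
  (forall e, 0 < e -> exists N, forall n m, (N <= n)%N -> (N <= m)%N -> `|a n - a m| <= e) ->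
  exists b, forall e, 0 < e -> exists N, forall n, (N <= n)%N -> `|a n - b| <= e.
Proof.
move=> H; pose E := [set x | exists N, forall n, (N <= n)%N -> x <= a n].
have [N1 H1] := H 1 ltr01.
have E0 : E !=set0.
  by exists (a N1 - 1); exists N1 => n Nn; have := H1 n N1 Nn (leqnn _); rewrite ler_norml; lra.
have Eub : has_ubound E.
  exists (a N1 + 1) => x [N HN].
  have := HN _ (leq_maxl N N1); have := H1 _ N1 (leq_maxr N N1) (leqnn _).
  by rewrite ler_norml; lra.
exists (sup E) => e e0; have [N HN] := H e e0; exists N => n Nn.
have lo : a n - e <= sup E.
  by apply: ub_le_sup => //; exists N => m Nm; have := HN n m Nn Nm; rewrite ler_norml; lra.
have hi : sup E <= a n + e.
  apply: ge_sup => // x [M HM].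
  have := HM _ (leq_maxl M N); have := HN n _ Nn (leq_maxr M N).
  by rewrite ler_norml; lra.
by rewrite ler_norml; lra.
Qed.

Lemma fuzzy_complete (s : nat -> R -> R) : (forall n, is_fuzzy (s n)) ->
  (forall e, 0 < e -> exists N, forall n m, (N <= n)%N -> (N <= m)%N -> Dist (s n) (s m) <= e) ->
  exists2 u, is_fuzzy u &
    forall e, 0 < e -> exists N, forall n, (N <= n)%N -> Dist (s n) u <= e.
Proof.
move=> fs cs.
(* [f] stands for [lower] or [upper]; all that is used is that its values at a level are 1-Lipschitz
   for [Dist]. *)
have limit (f : (R -> R) -> R -> R) : (forall u v r, is_fuzzy u -> is_fuzzy v -> 0 <= r <= 1 ->
    `|f u r - f v r| <= Dist u v) -> exists l : R -> R, forall e, 0 < e ->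
    exists N, forall n r, 0 <= r <= 1 -> (N <= n)%N -> `|f (s n) r - l r| <= e.
  move=> fD; have ex r : exists b, 0 <= r <= 1 -> forall e, 0 < e -> exists N, forall n, (N <= n)%N -> `|f (s n) r - b| <= e.
    have [r01|] := boolP (0 <= r <= 1); last by exists 0.
    have [|b Hb] := @real_cauchy (fun n => f (s n) r); last by exists b.
    move=> e /cs[N HN]; exists N => n m Nn Nm.
    exact: le_trans (fD _ _ _ (fs n) (fs m) r01) (HN n m Nn Nm).
  have [l Hl] := choice ex; exists l => e e0.
  (* The rank [N] comes from the Cauchy condition in [Dist] and is the same for all [r], so the
     pointwise limit is uniform. *)
  have [N HN] := cs e e0; exists N => n r r01 Nn; apply/ler_addgt0Pr => d d0.
  have [M HM] := Hl r r01 d d0.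
  apply: le_trans (ler_distD (f (s (maxn N M)) r) _ _) _; apply: lerD; last by apply: HM; exact: leq_maxr.
  by apply: le_trans (fD _ _ _ (fs _) (fs _) r01) _; apply: HN => //; exact: leq_maxl.
have [|l Hl] := limit (@lower R); first by move=> u v r fu fv r01; have [] := Dist_ge fu fv r01.
have [|m Hm] := limit (@upper R); first by move=> u v r fu fv r01; have [] := Dist_ge fu fv r01.
have lm : level_pair l m.
  split.
  - apply: lhalf_unif => e /Hl[N HN]; exists (lower (s N)).
      by have [] := fuzzy_level_pair (fs N).
    by move=> r r01; rewrite distrC; exact: HN.
  - apply: lhalf_unif => e /Hm[N HN]; exists (\- upper (s N)).
      by have [] := fuzzy_level_pair (fs N).
    by move=> r r01; rewrite /= normr_oppB distrC; exact: HN.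
  - apply/ler_addgt0Pr => e e0.
    have [N HN] := Hl (e / 2) ltac:(lra); have [M HM] := Hm (e / 2) ltac:(lra).
    have := HN _ 1 ltac:(lra) (leq_maxl N M); have := HM _ 1 ltac:(lra) (leq_maxr N M).
    have [_ _] := fuzzy_level_pair (fs (maxn N M)).
    by rewrite !ler_norml; lra.
have [u ru] := level_pair_represented lm.
exists u; first exact: represented_fuzzy lm ru.
move=> e e0; have [N HN] := Hl e e0; have [M HM] := Hm e e0.
exists (maxn N M) => n; rewrite geq_max => /andP[Nn Mn].
apply: Dist_le => r r01.
rewrite (represented_lower lm ru) // (represented_upper lm ru) //.
by split; [exact: HN|exact: HM].
Qed.

End FuzzyMetric.

(** * Spaces with a supremum metric *)

Section SupSpaces.
Variable R : realType.

(** [z <= 1/2] gives [z^n <= 1/(n+1)], which leaves the archimedean property. Both ratios 1/4 and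
    1/2 occur later. *)
Lemma geometric_small (z C e : R) : 0 <= z <= 2^-1 -> 0 < e ->
  exists N, forall n, (N <= n)%N -> C * z ^+ n <= e.
Proof.
move=> /andP[z0 z2] e0.
have bound n : z ^+ n <= n.+1%:R^-1.
  elim: n => [|n IH]; first by rewrite expr0 invr1.
  rewrite exprS; apply: le_trans (ler_pM z0 _ z2 IH) _; first by rewrite exprn_ge0.
  rewrite -invfM lef_pV2 ?posrE ?mulr_gt0 // -natrM ler_nat.
  by rewrite mulnS -addn2 addnC leq_add // leq_pmull.
exists (Num.bound (`|C| / e)) => n Nn.
apply: le_trans (ler_wpM2r _ (ler_norm C)) _; first by rewrite exprn_ge0.
apply: le_trans (ler_wpM2l _ (bound n)) _ => //.
rewrite ler_pdivrMr // mulrC -ler_pdivrMr //.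
have /archi_boundP/ltW/le_trans -> // : 0 <= `|C| / e by rewrite divr_ge0 // ltW.
by rewrite ler_nat (leq_trans Nn).
Qed.

Lemma quarter_pow_small (C e : R) : 0 < e ->
  exists N, forall n, (N <= n)%N -> C * 4^-1 ^+ n <= e.
Proof. by apply: geometric_small; lra. Qed.

Lemma RF_metric_cone : metric_cone (RF_space R).
Proof.
split=> /=.
- exact: fuzzy0.
- by move=> u v; exact: fuzzyD.
- by move=> l u; exact: fuzzyZ.
- by move=> u v; exact: Dist_ge0.
- by move=> u v _ _; exact: Dist_sym.
- by move=> u v w fu fv fw; exact: Dist_tri.
- by move=> u v; exact: Dist_addl.
- by move=> l u; exact: Dist0Z.
Qed.

Notation fsum y := (@partial_sum R (RF_space R) y).

(** The rate depends on nothing but [n]: applied pointwise to functions, it gives uniform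
    convergence. *)
Lemma fuzzy_series (y : nat -> R -> R) :
  (forall n, is_fuzzy (y n)) -> (forall n, Dist (@fzero R) (y n) <= 4^-1 ^+ n) ->
  exists2 u, is_fuzzy u & forall n, Dist (fsum y n) u <= 2 * 4^-1 ^+ n.
Proof.
move=> fy y4.
have c0 n : 0 <= (4^-1 : R) ^+ n by rewrite exprn_ge0.
have cS n : (4^-1 : R) ^+ n.+1 <= 4^-1 ^+ n / 2 by rewrite exprSr; move: (c0 n); lra.
have fs n : is_fuzzy (fsum y n) := partial_sum_in RF_metric_cone n fy.
have cauchy := partial_sum_cauchy RF_metric_cone fy y4 c0 cS.
have [|u fu cvu] := fuzzy_complete fs.
  move=> e e0; have [N HN] := quarter_pow_small 4 e0; exists N => n m Nn Nm.
  have H k : (N <= k)%N -> Dist (fsum y N) (fsum y k) <= 2 * 4^-1 ^+ N.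
    by move=> Nk; rewrite -(subnKC Nk); exact: cauchy.
  apply: le_trans (Dist_tri (fs n) (fs N) (fs m)) _; rewrite Dist_sym.
  by have := H n Nn; have := H m Nm; have := HN N (leqnn N); lra.
by exists u => //; exact: (partial_sum_tail RF_metric_cone fy fu y4 c0 cS cvu).
Qed.

Lemma RF_series_complete : series_complete (RF_space R).
Proof.
move=> y fy y4; have [u fu H] := fuzzy_series fy y4; exists u => // e e0.
have [N HN] := quarter_pow_small 2 e0; exists N => n Nn.
exact: le_trans (H n) (HN n Nn).
Qed.

(** * Families of fuzzy numbers with the supremum metric *)

Section Sup.
Variables (T : Type) (S : set T) (mem : (T -> R -> R) -> Prop).

(** The spaces of continuous functions and of bounded, convergent and null sequences unfold to this
    form, with [S] the segment or all of [nat]. *)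
Definition sup_space : fspace R :=
  @FSpace R (T -> R -> R) mem (fun f g t => fadd (f t) (g t))
    (fun l f t => fsmul l (f t)) (fun=> @fzero R)
    (fun f g => sup [set Dist (f t) (g t) | t in S]).

(** [sup_bounded] makes the real supremum meaningful; [sup_limit], closedness under uniform
    approximation, is what completeness rests on. *)
Record sup_family : Prop := SupFamily {
  sup_dom : S !=set0;
  sup_fuzzy : forall f t, mem f -> S t -> is_fuzzy (f t);
  sup_bounded : forall f, mem f -> exists M, forall t, S t -> Dist (f t) (@fzero R) <= M;
  sup_zero : mem (fun=> @fzero R);
  sup_add : forall f g, mem f -> mem g -> mem (fun t => fadd (f t) (g t));
  sup_smul : forall l f, 0 <= l -> mem f -> mem (fun t => fsmul l (f t));
  sup_limit : forall f, (forall t, S t -> is_fuzzy (f t)) ->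
    (forall e, 0 < e -> exists2 g, mem g & forall t, S t -> Dist (g t) (f t) <= e) ->
    mem f }.

Hypothesis F : sup_family.
Local Notation supD := (@sdist R sup_space).

Lemma supD_ge f g t : mem f -> mem g -> S t -> Dist (f t) (g t) <= supD f g.
Proof.
move=> mf mg St; apply: ub_le_sup; last by exists t.
have [M HM] := sup_bounded F mf; have [N HN] := sup_bounded F mg.
exists (M + N) => _ [s Ss <-]; have f0 := @fuzzy0 R.
apply: le_trans (Dist_tri (sup_fuzzy F mf Ss) f0 (sup_fuzzy F mg Ss)) _.
by rewrite (Dist_sym (@fzero R)); apply: lerD; [exact: HM|exact: HN].
Qed.

Lemma supD_le f g c : (forall t, S t -> Dist (f t) (g t) <= c) -> supD f g <= c.
Proof.
move=> H; apply: ge_sup; last by move=> _ [t St <-]; exact: H.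
by have [t St] := sup_dom F; exists (Dist (f t) (g t)); exists t.
Qed.

Lemma supD_ge0 f g : mem f -> mem g -> 0 <= supD f g.
Proof.
move=> mf mg; have [t St] := sup_dom F; apply: le_trans (supD_ge mf mg St).
by apply: Dist_ge0; exact: sup_fuzzy St.
Qed.

Lemma supD_eq f g f' g' : (forall t, S t -> Dist (f t) (g t) = Dist (f' t) (g' t)) ->
  supD f g = supD f' g'.
Proof.
move=> H; congr sup; apply/seteqP.
by split=> _ [t St <-]; exists t => //; rewrite H.
Qed.

Lemma sup_metric_cone : metric_cone sup_space.
Proof.
split=> /=.
- exact: sup_zero.
- exact: sup_add.
- by move=> l f; exact: sup_smul.
- exact: supD_ge0.
- by move=> f g _ _; apply: supD_eq => t _; exact: Dist_sym.
- move=> f g h mf mg mh; apply: supD_le => t St.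
  apply: le_trans (Dist_tri _ (sup_fuzzy F mg St) _) _; [exact: sup_fuzzy St|exact: sup_fuzzy St|].
  by apply: lerD; exact: supD_ge.
- move=> f g mf mg; apply: (@supD_eq _ _ (fun=> @fzero R)) => t St.
  by apply: Dist_addl; exact: sup_fuzzy St.
- move=> l f l0 mf; have ml := sup_smul F l0 mf; have m0 := sup_zero F.
  have E t : S t -> Dist (@fzero R) (fsmul l (f t)) = l * Dist (@fzero R) (f t).
    by move=> St; apply: Dist0Z => //; exact: sup_fuzzy St.
  rewrite /snorm; apply/eqP; rewrite eq_le; apply/andP; split.
    by apply: supD_le => t St; rewrite E // ler_wpM2l //; exact: (supD_ge m0 mf).
  have [lE|lN0] := eqVneq l 0; first by rewrite {1}lE mul0r; exact: supD_ge0.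
  have lpos : 0 < l by rewrite lt_neqAle eq_sym lN0.
  rewrite mulrC -ler_pdivlMr //; apply: supD_le => t St.
  by rewrite ler_pdivlMr // mulrC -E //; exact: (supD_ge m0 ml).
Qed.

(** The limit is chosen point by point, with an irrelevant value outside [S]. The explicit uniform
    rate is used again for the derivatives in C^p. *)
Lemma sup_series (y : nat -> T -> R -> R) :
  (forall n, mem (y n)) -> (forall n, @snorm R sup_space (y n) <= 4^-1 ^+ n) ->
  exists2 x, mem x & forall n t, S t ->
    Dist (@partial_sum R sup_space y n t) (x t) <= 2 * 4^-1 ^+ n.
Proof.
move=> my y4.
have ps n t : @partial_sum R sup_space y n t = fsum (y^~ t) n.
  by elim: n => //= n ->.
have ex t : exists u, S t -> is_fuzzy u /\ forall n, Dist (fsum (y^~ t) n) u <= 2 * 4^-1 ^+ n.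
  have [St|nSt] := pselect (S t); last by exists (@fzero R).
  have [|n|u fu Hu] := @fuzzy_series (y^~ t); last by exists u.
    by move=> n; exact: sup_fuzzy St.
  by apply: le_trans (y4 n); exact: (supD_ge (sup_zero F) (my n)).
have [x Hx] := choice ex.
have Hs n t : S t -> Dist (@partial_sum R sup_space y n t) (x t) <= 2 * 4^-1 ^+ n.
  by move=> St; rewrite ps; apply: (Hx t St).2.
exists x => //; apply: sup_limit => // [t St|e e0]; first exact: (Hx t St).1.
have [N HN] := quarter_pow_small 2 e0; exists (@partial_sum R sup_space y N).
  exact: (partial_sum_in sup_metric_cone N my).
by move=> t St; apply: le_trans (Hs N t St) (HN N _).
Qed.

Lemma sup_series_complete : series_complete sup_space.
Proof.
move=> y my y4; have [x mx H] := sup_series my y4; exists x => // e e0.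
have [N HN] := quarter_pow_small 2 e0; exists N => n Nn.
by apply: supD_le => t St; apply: le_trans (H n t St) (HN n Nn).
Qed.

End Sup.

(** * Bounded, convergent and null sequences *)

Lemma m_family : sup_family [set: nat] (@m_mem R).
Proof.
have f0 := @fuzzy0 R; split.
- by exists 0%N.
- by move=> f t [ff _] _.
- by move=> f [_ [M HM]]; exists M.
- by split=> //; exists 0 => n; rewrite Dist_refl.
- move=> f g [ff [M HM]] [fg [N HN]]; split=> [n|]; first exact: fuzzyD.
  exists (M + N) => n; rewrite -(fadd0 f0).
  by apply: le_trans (DistD _ _ _ _) _ => //; exact: lerD.
- move=> l f l0 [ff [M HM]]; split=> [n|]; first exact: fuzzyZ.
  by exists (l * M) => n; rewrite Dist_sym Dist0Z // ler_wpM2l // Dist_sym.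
- move=> f ff H; split=> [n|]; first exact: ff.
  have [g [fg [M HM]] gf] := H 1 ltr01; exists (1 + M) => n.
  apply: le_trans (Dist_tri (ff n I) (fg n) f0) _; rewrite Dist_sym.
  by apply: lerD => //; exact: gf.
Qed.

Lemma c_mem_bounded (f : nat -> R -> R) : c_mem f -> m_mem f.
Proof.
have f0 := @fuzzy0 R; move=> [ff [u fu Hu]]; split=> //.
have [N HN] := Hu 1 ltr01.
(* The first terms are bounded by their sum, the others by being within 1 of the limit. *)
exists (1 + Dist u (@fzero R) + \sum_(i < N) Dist (f i) (@fzero R)) => n.
have D0 v : is_fuzzy v -> 0 <= Dist v (@fzero R) by move=> fv; exact: Dist_ge0.
have [nN|Nn] := ltnP n N.
  rewrite (bigD1 (Ordinal nN)) //= addrCA lerDl addr_ge0 //; first by rewrite addr_ge0 // D0.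
  by apply: sumr_ge0 => i _; exact: D0.
apply: le_trans (Dist_tri (ff n) fu f0) _; apply: ler_wpDr.
  by apply: sumr_ge0 => i _; exact: D0.
by rewrite lerD2r ltW // HN.
Qed.

Lemma c0_mem_c (f : nat -> R -> R) : c0_mem f -> c_mem f.
Proof. by move=> [ff H]; split=> //; exists (@fzero R) => //; exact: fuzzy0. Qed.

Lemma seq_limitD (f g : nat -> R -> R) u v : (forall n, is_fuzzy (f n)) ->
  (forall n, is_fuzzy (g n)) -> is_fuzzy u -> is_fuzzy v ->
  (forall e, 0 < e -> exists N, forall n, (N <= n)%N -> Dist (f n) u < e) ->
  (forall e, 0 < e -> exists N, forall n, (N <= n)%N -> Dist (g n) v < e) ->
  forall e, 0 < e -> exists N, forall n, (N <= n)%N -> Dist (fadd (f n) (g n)) (fadd u v) < e.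
Proof.
move=> ff fg fu fv Hf Hg e e0.
have [N HN] := Hf (e / 2) ltac:(lra); have [M HM] := Hg (e / 2) ltac:(lra).
exists (maxn N M) => n; rewrite geq_max => /andP[Nn Mn].
apply: le_lt_trans (DistD _ _ _ _) _ => //.
by have := HN n Nn; have := HM n Mn; lra.
Qed.

Lemma seq_limitZ l (f : nat -> R -> R) u : 0 <= l -> (forall n, is_fuzzy (f n)) -> is_fuzzy u ->
  (forall e, 0 < e -> exists N, forall n, (N <= n)%N -> Dist (f n) u < e) ->
  forall e, 0 < e -> exists N, forall n, (N <= n)%N -> Dist (fsmul l (f n)) (fsmul l u) < e.
Proof.
move=> l0 ff fu Hf e e0.
have [|N HN] := Hf (e / (l + 1)); first by rewrite divr_gt0 // ltr_wpDl.
exists N => n Nn; rewrite DistZ //.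
have := HN n Nn; rewrite ltr_pdivlMr ?ltr_wpDl //.
by have := Dist_ge0 (ff n) fu; nra.
Qed.

Lemma c0_family : sup_family [set: nat] (@c0_mem R).
Proof.
have f0 := @fuzzy0 R; split.
- by exists 0%N.
- by move=> f t [ff _] _.
- by move=> f /c0_mem_c/c_mem_bounded[_ [M HM]]; exists M.
- by split=> // e e0; exists 0%N => n _; rewrite Dist_refl.
- move=> f g [ff Hf] [fg Hg]; split=> [n|]; first exact: fuzzyD.
  by rewrite -(fadd0 f0); exact: seq_limitD.
- move=> l f l0 [ff Hf]; split=> [n|]; first exact: fuzzyZ.
  by rewrite -(fsmul0 l0); exact: seq_limitZ.
- move=> f ff H; split=> [n|e e0]; first exact: ff.
  have [g [fg Hg] gf] := H (e / 2) ltac:(lra).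
  have [N HN] := Hg (e / 2) ltac:(lra); exists N => n Nn.
  apply: le_lt_trans (Dist_tri (ff n I) (fg n) f0) _; rewrite Dist_sym.
  by have := HN n Nn; have := gf n I; lra.
Qed.

Lemma c_family : sup_family [set: nat] (@c_mem R).
Proof.
have f0 := @fuzzy0 R; split.
- by exists 0%N.
- by move=> f t [ff _] _.
- by move=> f /c_mem_bounded[_ [M HM]]; exists M.
- by apply/c0_mem_c/(sup_zero c0_family).
- move=> f g [ff [u fu Hf]] [fg [v fv Hg]]; split=> [n|]; first exact: fuzzyD.
  by exists (fadd u v); [exact: fuzzyD|exact: seq_limitD].
- move=> l f l0 [ff [u fu Hf]]; split=> [n|]; first exact: fuzzyZ.
  by exists (fsmul l u); [exact: fuzzyZ|exact: seq_limitZ].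
- move=> f ff0 H; have ff n := ff0 n I; split=> //.
  (* The limit comes from completeness: eventually all [f k] are within [e / 2] of the limit of one
     approximant. *)
  have [|u fu Hu] := fuzzy_complete ff.
    move=> e e0; have [g [fg [v fv Hg]] gf] := H (e / 4) ltac:(lra).
    have [N HN] := Hg (e / 4) ltac:(lra); exists N => n m Nn Nm.
    have near k : (N <= k)%N -> Dist (f k) v <= e / 2.
      move=> Nk; apply: le_trans (Dist_tri (ff k) (fg k) fv) _; rewrite Dist_sym.
      by have := HN k Nk; have := gf k I; lra.
    apply: le_trans (Dist_tri (ff n) fv (ff m)) _; rewrite (Dist_sym v).
    by have := near n Nn; have := near m Nm; lra.
  exists u => // e e0; have [N HN] := Hu (e / 2) ltac:(lra).
  by exists N => n /HN; lra.
Qed.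

(** * Continuous functions on a segment *)

(** At the infimum [z] of the counterexamples the property holds, by the start or by the passage
    from the left; its extension to the right of [z] then contradicts the infimum. This stands in
    for compactness of the segment. *)
Lemma real_induction (a b : R) (P : R -> Prop) : P a ->
  (forall s, a <= s < b -> (forall t, a <= t <= s -> P t) ->
    exists2 d, 0 < d & forall t, s < t < s + d -> t <= b -> P t) ->
  (forall s, a < s <= b -> (forall t, a <= t < s -> P t) -> P s) ->
  forall s, a <= s <= b -> P s.
Proof.
move=> Pa Pr Pl s sab; apply: contrapT => nPs.
pose E := [set t | a <= t <= b /\ ~ P t].
have E0 : E !=set0 by exists s.
have Elb : has_lbound E by exists a => t []; lra.
pose z := inf E.
have az : a <= z by apply: lb_le_inf => // t []; lra.
have zlb t : E t -> z <= t by move=> Et; exact: (ge_inf Elb Et).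
have zs : z <= s by exact: zlb.
have below t : a <= t < z -> P t.
  move=> /andP[at_ tz]; apply: contrapT => nPt.
  have Et : E t by split=> //; apply/andP; split=> //; lra.
  by have := zlb t Et; lra.
have Pz : P z.
  by have [->//|zNa] := eqVneq z a; apply: Pl => //; rewrite lt_neqAle eq_sym zNa; lra.
have zb : z < b.
  rewrite lt_neqAle; apply/andP; split; last lra.
  by apply/eqP => zb; apply: nPs; have -> : s = z by lra.
have [|t tz|d d0 Hd] := Pr z; first lra.
  have [->//|tNz] := eqVneq t z; apply: below; rewrite (lt_neqAle t z) tNz; lra.
have [|t [tab nPt] tz] := @inf_lt _ E (z + d) E0; first by rewrite ltrDl.
have zt : z <= t by apply: zlb; split.
apply: nPt; have [E1|tNz] := eqVneq t z; first by rewrite E1.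
apply: Hd; last by case/andP: tab.
by rewrite tz andbT lt_neqAle eq_sym tNz.
Qed.

Lemma C_family (a b : R) : a < b -> sup_family [set t | a <= t <= b] (C_mem a b).
Proof.
have f0 := @fuzzy0 R; move=> ab; split.
- by exists a => /=; rewrite lexx ltW.
- by move=> f t [ff _]; exact: ff.
- move=> f [ff cf].
  (* The property propagated is boundedness on [[a, s]]; continuity at [s] extends it past [s], and
     also reaches [s] from the left. *)
  suff H s : a <= s <= b -> exists M, forall t, a <= t <= s -> Dist (f t) (@fzero R) <= M.
    by have [|M HM] := H b; [rewrite ltW /=|exists M].
  move: s; apply: real_induction.
  + by exists (Dist (f a) (@fzero R)) => t ?; have -> : t = a by lra.
  + move=> s sab /(_ s ltac:(lra))[M HM].
    have sab' : a <= s <= b by lra.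
    have [d d0 Hd] := cf s sab' 1 ltr01; exists d => // t st tb.
    exists (Num.max M (1 + Dist (f s) (@fzero R))) => r rt; rewrite le_max.
    have [rs|sr] := leP r s; first by rewrite HM //; lra.
    have rab : a <= r <= b by lra.
    apply/orP; right; apply: le_trans (Dist_tri (ff r rab) (ff s sab') f0) _.
    by rewrite lerD2r ltW // Hd // ger0_norm; lra.
  + move=> s sab H; have sab' : a <= s <= b by lra.
    have [d d0 Hd] := cf s sab' 1 ltr01.
    (* A point of [[a, s)] beyond which [f] stays within 1 of [f s]; the maximum with [a] keeps it
       in the segment. *)
    have [M HM] := H (Num.max a (s - d / 2)) ltac:(rewrite le_max lexx gt_max; lra).
    exists (Num.max M (1 + Dist (f s) (@fzero R))) => r rs; rewrite le_max.
    have [rm|mr] := leP r (Num.max a (s - d / 2)); first by rewrite HM // rm; lra.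
    have rab : a <= r <= b by lra.
    move: mr; rewrite gt_max => /andP[_ mr].
    apply/orP; right; apply: le_trans (Dist_tri (ff r rab) (ff s sab') f0) _.
    by rewrite lerD2r ltW // Hd // ler0_norm; lra.
- split=> // t _ e e0; exists 1 => // s _ _; by rewrite Dist_refl.
- move=> f g [ff cf] [fg cg]; split=> [t tab|t tab e e0].
    by apply: fuzzyD; [exact: ff|exact: fg].
  have [d d0 Hd] := cf t tab (e / 2) ltac:(lra).
  have [d' d0' Hd'] := cg t tab (e / 2) ltac:(lra).
  exists (Num.min d d'); first by rewrite lt_min d0.
  move=> s sab; rewrite lt_min => /andP[sd sd'].
  apply: le_lt_trans (DistD (ff s sab) (fg s sab) (ff t tab) (fg t tab)) _.
  by have := Hd s sab sd; have := Hd' s sab sd'; lra.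
- move=> l f l0 [ff cf]; split=> [t tab|t tab e e0].
    by apply: fuzzyZ => //; exact: ff.
  have [|d d0 Hd] := cf t tab (e / (l + 1)); first by rewrite divr_gt0 // ltr_wpDl.
  exists d => // s sab st; rewrite DistZ //; [|exact: ff|exact: ff].
  have := Hd s sab st; rewrite ltr_pdivlMr ?ltr_wpDl //.
  by have := Dist_ge0 (ff s sab) (ff t tab); nra.
- move=> f ff H; split=> // t tab e e0.
  have [g [fg cg] gf] := H (e / 3) ltac:(lra).
  have [d d0 Hd] := cg t tab (e / 3) ltac:(lra).
  exists d => // s sab st.
  apply: le_lt_trans (Dist_tri (ff s sab) (fg s sab) (ff t tab)) _.
  have := Dist_tri (fg s sab) (fg t tab) (ff t tab).
  rewrite (Dist_sym (f s)).
  by have := Hd s sab st; have := gf s sab; have := gf t tab; lra.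
Qed.

(** * Finite products *)

Lemma prod_metric_cone (X Y : fspace R) :
  metric_cone X -> metric_cone Y -> metric_cone (prod_space X Y).
Proof.
move=> gX gY; split=> /=.
- by split; exact: cone_zero.
- by move=> x y [? ?] [? ?]; split; exact: cone_add.
- by move=> l x l0 [? ?]; split; exact: cone_smul.
- by move=> x y [x1 x2] [y1 y2]; rewrite le_max (cone_ge0 gX).
- by move=> x y [x1 x2] [y1 y2]; rewrite (cone_sym gX) // (cone_sym gY).
- move=> x y z [x1 x2] [y1 y2] [z1 z2]; rewrite ge_max.
  have H1 := cone_tri gX x1 y1 z1; have H2 := cone_tri gY x2 y2 z2.
  apply/andP; split.
    by apply: le_trans H1 _; apply: lerD; rewrite le_max lexx.
  by apply: le_trans H2 _; apply: lerD; rewrite le_max lexx orbT.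
- by move=> x y [x1 x2] [y1 y2]; rewrite (cone_addl gX) // (cone_addl gY).
- move=> l x l0 [x1 x2]; have := cone_norm_smul gX l0 x1; have := cone_norm_smul gY l0 x2.
  by rewrite /snorm /= => -> ->; rewrite maxr_pMr.
Qed.

Lemma prod_series_complete (X Y : fspace R) :
  series_complete X -> series_complete Y -> series_complete (prod_space X Y).
Proof.
move=> cX cY y my y4.
have [|n|x xX Hx] := cX (fun n => (y n).1); first by move=> n; case: (my n).
  by apply: le_trans (y4 n); rewrite /snorm /= le_max lexx.
have [|n|z zY Hz] := cY (fun n => (y n).2); first by move=> n; case: (my n).
  by apply: le_trans (y4 n); rewrite /snorm /= le_max lexx orbT.
exists (x, z) => //= e e0.
have [N HN] := Hx e e0; have [M HM] := Hz e e0.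
have ps n : @partial_sum R (prod_space X Y) y n =
    (@partial_sum R X (fun n => (y n).1) n, @partial_sum R Y (fun n => (y n).2) n).
  by elim: n => //= n ->.
exists (maxn N M) => n; rewrite geq_max => /andP[Nn Mn].
by rewrite ps /= ge_max HN // HM.
Qed.

End SupSpaces.

(** * Lebesgue spaces *)

Section LebesgueSpaces.
Variable R : realType.

(** * Reduction to countably many levels *)

(** Enumerates the rationals of [0, 1], every other code giving 0. It turns [Dist] into a countable
    supremum, hence into a measurable function of [t]. *)
Definition unit_rat (n : nat) : R :=
  if unpickle n is Some q then if 0 <= (ratr q : R) <= 1 then ratr q else 0 else 0.

Lemma unit_rat01 n : 0 <= unit_rat n <= 1.
Proof. by rewrite /unit_rat; case: unpickle => [q|]; [case: ifP => //|]; rewrite lexx ler01. Qed.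

Lemma unit_rat_dense (x y : R) : 0 <= x -> x < y -> y <= 1 -> exists n, x < unit_rat n < y.
Proof.
move=> x0 xy y1; have [q] := rat_in_itvoo xy; rewrite in_itv /= => /andP[xq qy].
exists (pickle q); rewrite /unit_rat pickleK.
have -> : 0 <= (ratr q : R) <= 1 by apply/andP; split; lra.
by rewrite xq.
Qed.

Lemma unit_rat_zero : exists n, unit_rat n = 0.
Proof. by exists (pickle (0 : rat)); rewrite /unit_rat pickleK rmorph0 lexx ler01. Qed.

(** For [r > 0], left continuity of [l] gives [s < r] with [l r - e < l s]. A rational [q] between
    [s] and [r] then satisfies [l s <= l q <= k q + c <= k r + c]. Level 0 is itself in the
    enumeration. *)
Lemma lhalf_sub_le (l k : R -> R) c : lhalf l -> lhalf k ->
  (forall n, l (unit_rat n) - k (unit_rat n) <= c) -> forall r, 0 <= r <= 1 -> l r - k r <= c.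
Proof.
move=> [l1 l2 _] [k1 _ _] H r /andP[r0 r1].
have [->|rN0] := eqVneq r 0; first by have [n <-] := unit_rat_zero; exact: H.
have rpos : 0 < r by rewrite lt_neqAle eq_sym rN0.
apply/ler_addgt0Pr => e e0.
have [||s /andP[s0 sr] ls] := l2 r (l r - e); [by rewrite rpos|lra|].
have [n /andP[sq qr]] := unit_rat_dense (ltW s0) sr r1.
have /andP[q0 q1] := unit_rat01 n.
have := H n; have := l1 s _ (ltW s0) (ltW sq) q1; have := k1 _ r q0 (ltW qr) r1; lra.
Qed.

Lemma lhalf_dist_le (l k : R -> R) c : lhalf l -> lhalf k ->
  (forall n, `|l (unit_rat n) - k (unit_rat n)| <= c) -> forall r, 0 <= r <= 1 -> `|l r - k r| <= c.
Proof.
move=> hl hk H r r01; rewrite ler_norml; apply/andP; split.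
  rewrite lerNl opprB; apply: lhalf_sub_le r01 => // n.
  by apply: le_trans (H n); rewrite distrC ler_norm.
by apply: lhalf_sub_le r01 => // n; apply: le_trans (H n); rewrite ler_norm.
Qed.

Lemma Dist_unit_rat (u v : R -> R) : is_fuzzy u -> is_fuzzy v ->
  Dist u v = sup (range (fun n => Num.max `|lower u (unit_rat n) - lower v (unit_rat n)|
                                       `|upper u (unit_rat n) - upper v (unit_rat n)|)).
Proof.
move=> fu fv; set E := range _.
have [lu mu _] := fuzzy_level_pair fu; have [lv mv _] := fuzzy_level_pair fv.
have Eub x : E x -> x <= Dist u v.
  move=> [n _ <-]; have [h1 h2] := Dist_ge fu fv (unit_rat01 n).
  by rewrite ge_max h1.
have Ebd : has_ubound E by exists (Dist u v).
have Esup n := ub_le_sup Ebd (imageP (fun n => Num.max `|lower u (unit_rat n) - lower v (unit_rat n)|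
                                       `|upper u (unit_rat n) - upper v (unit_rat n)|) (I : [set: nat] n)).
apply/eqP; rewrite eq_le; apply/andP; split; last first.
  apply: ge_sup; last by move=> x; exact: Eub.
  by exists (Num.max `|lower u (unit_rat 0) - lower v (unit_rat 0)|
                     `|upper u (unit_rat 0) - upper v (unit_rat 0)|); exists 0%N.
apply: Dist_le => r r01; split.
  by apply: lhalf_dist_le r01 => // n; apply: le_trans (Esup n); rewrite le_max lexx.
rewrite -normr_oppB; apply: (lhalf_dist_le mu mv _ r01) => n.
by rewrite /= normr_oppB; apply: le_trans (Esup n); rewrite le_max lexx orbT.
Qed.

(** * L^p over an arbitrary measure, for functions and sequences alike *)

Section Lp.
Variables (d : measure_display) (T : measurableType d) (mu : {measure set T -> \bar R}).
Variables (S : set T) (p : R).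
Hypotheses (mS : measurable S) (p1 : 1 <= p).
Implicit Types (h k : T -> R) (f g : T -> R -> R).

Let p0 : 0 <= p. Proof. exact: le_trans p1. Qed.
Let pN0 : p != 0. Proof. by rewrite gt_eqF // (lt_le_trans _ p1). Qed.
Let pVp (x : R) : 0 <= x -> (x `^ p) `^ p^-1 = x.
Proof. by move=> x0; rewrite -powRrM mulfV // powRr1. Qed.

(** Kept in the extended reals, because [pnorm] takes [fine] of it and says nothing sensible when it
    is infinite. *)
Definition powint (h : T -> R) : \bar R := (\int[mu]_(t in S) (h t `^ p)%:E)%E.
Definition pnorm (h : T -> R) : R := fine (powint h) `^ p^-1.

Let mpow (h : T -> R) : measurable_fun S h -> measurable_fun S (fun t => (h t `^ p)%:E).
Proof.
by move=> mh; apply/measurable_EFinP; exact: (measurableT_comp (measurable_powR p) mh).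
Qed.

Lemma powint_ge0 h : (0 <= powint h)%E.
Proof. by apply: integral_ge0 => t _; rewrite lee_fin powR_ge0. Qed.

Lemma eq_powint h k : (forall t, S t -> h t = k t) -> powint h = powint k.
Proof. by move=> hk; apply: eq_integral => t; rewrite inE => St; rewrite hk. Qed.

Lemma powint_le h k : measurable_fun S h -> measurable_fun S k ->
  (forall t, S t -> 0 <= h t <= k t) -> (powint h <= powint k)%E.
Proof.
move=> mh mk hk; apply: ge0_le_integral => //.
- by move=> t _; rewrite lee_fin powR_ge0.
- exact: mpow.
- exact: mpow.
- move=> t /hk /andP[h0 hkt]; rewrite lee_fin ge0_ler_powR ?nnegrE //.
  exact: le_trans hkt.
Qed.

Lemma powintZ c h : 0 <= c -> measurable_fun S h -> (forall t, S t -> 0 <= h t) ->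
  powint (fun t => c * h t) = ((c `^ p)%:E * powint h)%E.
Proof.
move=> c0 mh h0; rewrite -ge0_integralZl_EFin ?powR_ge0 //; last exact: mpow.
  by apply: eq_integral => t; rewrite inE => /h0 ht; rewrite powRM.
by move=> t _; rewrite lee_fin powR_ge0.
Qed.

(** [h + k] is at most twice the larger of the two, so its p-th power is at most
    [(2h)^p + (2k)^p]. *)
Lemma powintD_lty h k : measurable_fun S h -> measurable_fun S k ->
  (forall t, S t -> 0 <= h t) -> (forall t, S t -> 0 <= k t) ->
  (powint h < +oo)%E -> (powint k < +oo)%E -> (powint (h \+ k)%R < +oo)%E.
Proof.
move=> mh mk h0 k0 hf kf.
apply: (@le_lt_trans _ _ (powint (fun t => 2 * h t)%R + powint (fun t => 2 * k t)%R)%E).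
  have m2 (g : T -> R) : measurable_fun S g -> measurable_fun S (fun t => 2 * g t).
    by move=> mg; apply: measurable_funM.
  rewrite -ge0_integralD //; [|by move=> t _; rewrite lee_fin powR_ge0|exact/mpow/m2
    |by move=> t _; rewrite lee_fin powR_ge0|exact/mpow/m2].
  apply: ge0_le_integral => //.
  - by move=> t _; rewrite lee_fin powR_ge0.
  - by apply: mpow; exact: measurable_funD.
  - by apply: emeasurable_funD; apply: mpow; exact: m2.
  - move=> t St; have ht := h0 t St; have kt := k0 t St; rewrite lee_fin /=.
    have [hk|kh] := leP (h t) (k t).
      apply: ler_wpDl; first exact: powR_ge0.
      by rewrite ge0_ler_powR ?nnegrE ?addr_ge0 ?mulr_ge0 //; lra.
    apply: ler_wpDr; first exact: powR_ge0.
    by rewrite ge0_ler_powR ?nnegrE ?addr_ge0 ?mulr_ge0 //; lra.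
rewrite (powintZ _ mh) // (powintZ _ mk) //.
have c0 : (0 <= (2 `^ p)%:E :> \bar R)%E by rewrite lee_fin powR_ge0.
apply: lte_add_pinfty; [exact: (lte_mul_pinfty c0 isT hf)|exact: (lte_mul_pinfty c0 isT kf)].
Qed.

Lemma pnorm_ge0 h : 0 <= pnorm h.
Proof. exact: powR_ge0. Qed.

Lemma eq_pnorm h k : (forall t, S t -> h t = k t) -> pnorm h = pnorm k.
Proof. by move=> hk; rewrite /pnorm (eq_powint hk). Qed.

Lemma powint_pnorm h : (powint h < +oo)%E -> powint h = (pnorm h `^ p)%:E.
Proof.
move=> hf; rewrite /pnorm -powRrM mulVf // powRr1 ?fine_ge0 ?powint_ge0 //.
by rewrite fineK // ge0_fin_numE ?powint_ge0.
Qed.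

Lemma pnorm_le_powint h c : 0 <= c -> (powint h <= (c `^ p)%:E)%E -> pnorm h <= c.
Proof.
move=> c0 hc; have hf : (powint h < +oo)%E by apply: le_lt_trans hc _; rewrite ltry.
rewrite -(pVp c0) /pnorm ge0_ler_powR ?nnegrE ?invr_ge0 ?powR_ge0 ?fine_ge0 ?powint_ge0 //.
by rewrite -lee_fin fineK // ge0_fin_numE ?powint_ge0.
Qed.

Lemma pnormZ c h : 0 <= c -> measurable_fun S h -> (forall t, S t -> 0 <= h t) ->
  (powint h < +oo)%E -> pnorm (fun t => c * h t) = c * pnorm h.
Proof.
move=> c0 mh h0 hf; rewrite /pnorm powintZ // (powint_pnorm hf) -EFinM /=.
by rewrite -powRM ?pnorm_ge0 // pVp ?mulr_ge0 ?pnorm_ge0 // /pnorm pVp ?pnorm_ge0.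
Qed.

(** Extension by zero off [S] gives access to Minkowski's inequality on the whole space. *)
Lemma Lnorm_patch h : (forall t, S t -> 0 <= h t) -> (powint h < +oo)%E ->
  Lnorm mu p%:E (EFin \o (h \_ S)) = (pnorm h)%:E.
Proof.
move=> h0 hf; rewrite unlock /Lnorm.
have -> : (\int[mu]_x (`|(EFin \o (h \_ S)) x| `^ p))%E = powint h.
  rewrite /powint [RHS]integral_mkcond; apply: eq_integral => t _ /=.
  rewrite /patch; case: ifPn => tS; last by rewrite normr0 powR0.
  by rewrite ger0_norm //; apply: h0; rewrite -inE.
by rewrite (powint_pnorm hf) poweR_EFin pVp ?pnorm_ge0.
Qed.

Lemma powint_zero : powint (fun=> 0) = 0%E.
Proof. by rewrite /powint powR0 // integral0. Qed.

Lemma powintE h : powint h = (\int[mu]_(t in S) (h t `^ p)%:E)%E.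
Proof. by []. Qed.

Opaque powint.

Lemma pnorm_le h k : measurable_fun S h -> measurable_fun S k ->
  (forall t, S t -> 0 <= h t <= k t) -> (powint k < +oo)%E -> pnorm h <= pnorm k.
Proof.
move=> mh mk hk kf; apply: pnorm_le_powint; first exact: pnorm_ge0.
by rewrite -(powint_pnorm kf); exact: powint_le.
Qed.

Lemma le_addr_of_ereal (A B C : \bar R) (x y z : R) :
  A = x%:E -> B = y%:E -> C = z%:E -> (A <= B + C)%E -> x <= y + z.
Proof. by move=> -> -> ->; rewrite -EFinD lee_fin. Qed.

Lemma pnormD h k : measurable_fun S h -> measurable_fun S k ->
  (forall t, S t -> 0 <= h t) -> (forall t, S t -> 0 <= k t) ->
  (powint h < +oo)%E -> (powint k < +oo)%E -> pnorm (h \+ k) <= pnorm h + pnorm k.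
Proof.
move=> mh mk h0 k0 hf kf.
have hk0 t : S t -> 0 <= (h \+ k) t by move=> St; rewrite addr_ge0 ?h0 ?k0.
have hkf := powintD_lty mh mk h0 k0 hf kf.
have E : (h \+ k) \_ S = (h \_ S) \+ (k \_ S).
  by apply/funext => t; rewrite /patch /=; case: ifP => // _; rewrite addr0.
apply: (le_addr_of_ereal (Lnorm_patch hk0 hkf) (Lnorm_patch h0 hf) (Lnorm_patch k0 kf)).
by rewrite E; apply: minkowski_EFin p1; apply/(measurable_restrictT _ mS).
Qed.

Definition Lebesgue_mem (f : T -> R -> R) : Prop :=
  [/\ (forall t, S t -> is_fuzzy (f t)),
      (forall r, 0 <= r <= 1 ->
          measurable_fun S (fun t => lower (f t) r) /\
          measurable_fun S (fun t => upper (f t) r))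
    & (powint (fun t => Dist (f t) (@fzero R)) < +oo)%E].

Definition Lebesgue_space : fspace R :=
  @FSpace R (T -> R -> R) Lebesgue_mem (fun f g t => fadd (f t) (g t))
    (fun l f t => fsmul l (f t)) (fun=> @fzero R)
    (fun f g => pnorm (fun t => Dist (f t) (g t))).

Definition level_measurable (f : T -> R -> R) := forall r, 0 <= r <= 1 ->
  measurable_fun S (fun t => lower (f t) r) /\ measurable_fun S (fun t => upper (f t) r).

(** By [Dist_unit_rat] the distance is the supremum of a sequence of measurable functions, written
    as [sups] from index 0. *)
Lemma measurable_Dist f g : (forall t, S t -> is_fuzzy (f t)) -> (forall t, S t -> is_fuzzy (g t)) ->
  level_measurable f -> level_measurable g ->
  measurable_fun S (fun t => Dist (f t) (g t)).
Proof.
move=> ff fg mf mg.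
pose h n t := Num.max `|lower (f t) (unit_rat n) - lower (g t) (unit_rat n)|
                      `|upper (f t) (unit_rat n) - upper (g t) (unit_rat n)|.
apply: (eq_measurable_fun (fun t => sups (h ^~ t) 0)).
  move=> t; rewrite inE => St; rewrite (Dist_unit_rat (ff t St) (fg t St)) /sups /sdrop.
  by congr sup; apply/seteqP; split=> _ [n _ <-]; exists n.
apply: measurable_fun_sups => [t St|n].
  exists (Dist (f t) (g t)) => _ [n _ <-].
  by have [h1 h2] := Dist_ge (ff t St) (fg t St) (unit_rat01 n); rewrite ge_max h1.
have [f1 f2] := mf _ (unit_rat01 n); have [g1 g2] := mg _ (unit_rat01 n).
by apply: measurable_maxr; apply: measurableT_comp => //; exact: measurable_funB.
Qed.

Lemma level_measurable_fzero : level_measurable (fun=> @fzero R).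
Proof. by move=> r _; split; exact: measurable_cst. Qed.

Lemma Lebesgue_mem_Dist f g : Lebesgue_mem f -> Lebesgue_mem g ->
  [/\ measurable_fun S (fun t => Dist (f t) (g t)),
    (forall t, S t -> 0 <= Dist (f t) (g t)) &
    (powint (fun t => Dist (f t) (g t)) < +oo)%E].
Proof.
move=> [ff mf If] [fg mg Ig]; have f0 := @fuzzy0 R.
have ge0 (h k : T -> R -> R) : (forall t, S t -> is_fuzzy (h t)) ->
    (forall t, S t -> is_fuzzy (k t)) -> forall t, S t -> 0 <= Dist (h t) (k t).
  by move=> fh fk t St; apply: Dist_ge0; [exact: fh|exact: fk].
have m0 := level_measurable_fzero.
have mfg := measurable_Dist ff fg mf mg.
have mf0 := measurable_Dist ff (fun=> fun=> f0) mf m0.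
have mg0 := measurable_Dist fg (fun=> fun=> f0) mg m0.
split; [exact: mfg|exact: ge0|].
apply: le_lt_trans (powintD_lty mf0 mg0 (ge0 _ _ ff (fun=> fun=> f0))
  (ge0 _ _ fg (fun=> fun=> f0)) If Ig).
apply: powint_le => [//||t St]; first exact: measurable_funD.
rewrite ge0 //=; apply: le_trans (Dist_tri (ff t St) f0 (fg t St)) _.
by rewrite (Dist_sym (@fzero R)).
Qed.

Lemma level_measurableD f g : (forall t, S t -> is_fuzzy (f t)) ->
  (forall t, S t -> is_fuzzy (g t)) -> level_measurable f -> level_measurable g ->
  level_measurable (fun t => fadd (f t) (g t)).
Proof.
move=> ff fg mf mg r r01; have [f1 f2] := mf r r01; have [g1 g2] := mg r r01; split.
  apply: (eq_measurable_fun (fun t => lower (f t) r + lower (g t) r)); last exact: measurable_funD.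
  by move=> t; rewrite inE => St; rewrite (lowerD (ff t St) (fg t St)).
apply: (eq_measurable_fun (fun t => upper (f t) r + upper (g t) r)); last exact: measurable_funD.
by move=> t; rewrite inE => St; rewrite (upperD (ff t St) (fg t St)).
Qed.

Lemma level_measurableZ l f : 0 <= l -> (forall t, S t -> is_fuzzy (f t)) ->
  level_measurable f -> level_measurable (fun t => fsmul l (f t)).
Proof.
move=> l0 ff mf r r01; have [f1 f2] := mf r r01; split.
  apply: (eq_measurable_fun (fun t => l * lower (f t) r)); last exact: measurable_funM.
  by move=> t; rewrite inE => St; rewrite (lowerZ l0 (ff t St)).
apply: (eq_measurable_fun (fun t => l * upper (f t) r)); last exact: measurable_funM.
by move=> t; rewrite inE => St; rewrite (upperZ l0 (ff t St)).
Qed.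

Lemma Lebesgue_zero : Lebesgue_mem (fun=> @fzero R).
Proof.
have f0 := @fuzzy0 R; split=> [//||]; first exact: level_measurable_fzero.
by rewrite Dist_refl // powint_zero ltry.
Qed.

Lemma Lebesgue_mem_le f k : (forall t, S t -> is_fuzzy (f t)) -> level_measurable f ->
  measurable_fun S k -> (forall t, S t -> Dist (f t) (@fzero R) <= k t) ->
  (powint k < +oo)%E -> Lebesgue_mem f.
Proof.
move=> ff mf mk fk kf; split=> [//|//|]; apply: le_lt_trans kf; have f0 := @fuzzy0 R.
apply: powint_le => [|//|t St].
  exact: (measurable_Dist ff (fun=> fun=> f0) mf level_measurable_fzero).
by rewrite fk // andbT; apply: Dist_ge0 => //; exact: ff.
Qed.

Lemma Lebesgue_metric_cone : metric_cone Lebesgue_space.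
Proof.
have f0 := @fuzzy0 R; have L0 := Lebesgue_zero.
split=> /=.
- exact: L0.
- move=> f g Lf Lg; have [ff mf If] := Lf; have [fg mg Ig] := Lg.
  have [mf0 f00 _] := Lebesgue_mem_Dist Lf L0; have [mg0 g00 _] := Lebesgue_mem_Dist Lg L0.
  apply: Lebesgue_mem_le (powintD_lty mf0 mg0 f00 g00 If Ig).
  + by move=> t St; apply: fuzzyD; [exact: ff|exact: fg].
  + exact: level_measurableD.
  + exact: measurable_funD.
  + move=> t St /=; rewrite -{1}(fadd0 f0).
    exact: (DistD (ff t St) (fg t St) f0 f0).
- move=> l f l0 Lf; have [ff mf If] := Lf; have [mf0 f00 _] := Lebesgue_mem_Dist Lf L0.
  apply: (@Lebesgue_mem_le _ (fun t => l * Dist (f t) (@fzero R))).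
  + by move=> t St; apply: fuzzyZ => //; exact: ff.
  + exact: level_measurableZ.
  + exact: measurable_funM.
  + by move=> t St; rewrite Dist_sym (Dist0Z l0 (ff t St)) Dist_sym.
  + rewrite (powintZ l0 mf0 f00).
    have c0 : (0 <= (l `^ p)%:E :> \bar R)%E by rewrite lee_fin powR_ge0.
    exact: (lte_mul_pinfty c0 isT If).
- by move=> f g _ _; exact: pnorm_ge0.
- by move=> f g _ _; apply: eq_pnorm => t _; exact: Dist_sym.
- move=> f g h Lf Lg Lh.
  have [ff _ _] := Lf; have [fg _ _] := Lg; have [fh _ _] := Lh.
  have [m1 n1 i1] := Lebesgue_mem_Dist Lf Lg; have [m2 n2 i2] := Lebesgue_mem_Dist Lg Lh.
  have [m3 n3 i3] := Lebesgue_mem_Dist Lf Lh.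
  apply: le_trans (pnormD m1 m2 n1 n2 i1 i2).
  apply: pnorm_le (powintD_lty m1 m2 n1 n2 i1 i2); [exact: m3|exact: measurable_funD|].
  by move=> t St; rewrite n3 //=; exact: (Dist_tri (ff t St) (fg t St) (fh t St)).
- move=> f g [ff _ _] [fg _ _]; apply: eq_pnorm => t St.
  exact: (Dist_addl (ff t St) (fg t St)).
- move=> l f l0 Lf; have [ff _ _] := Lf; rewrite /snorm /=.
  have [m n i] := Lebesgue_mem_Dist L0 Lf; rewrite -(pnormZ l0 m n i).
  by apply: eq_pnorm => t St; exact: (Dist0Z l0 (ff t St)).
Qed.

(** With [a_j = D(0, y_j)] and [B = sum_j (2^j a_j)^p], the integral of [B] is at most 2. Where [B]
    is finite, [a_j <= B^(1/p) 2^-j], so the series converges there at rate [2 B^(1/p) 2^-n].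
    Integrating the p-th power of this rate bounds the error in norm. *)
Lemma Lebesgue_series_complete : series_complete Lebesgue_space.
Proof.
move=> y Ly y4; have f0 := @fuzzy0 R; have L0 := Lebesgue_zero.
pose a j t := Dist (@fzero R) (y j t).
have am j : measurable_fun S (a j) by have [] := Lebesgue_mem_Dist L0 (Ly j).
have a0 j t : S t -> 0 <= a j t by have [_ + _] := Lebesgue_mem_Dist L0 (Ly j); exact.
have afin j : (powint (a j) < +oo)%E by have [] := Lebesgue_mem_Dist L0 (Ly j).
pose w (j : nat) : R := 2 ^+ j.
have w0 j : 0 < w j by rewrite exprn_gt0.
pose z j t := w j * a j t.
have zm j : measurable_fun S (z j) by exact: measurable_funM.
have z0 j t : S t -> 0 <= z j t by move=> St; rewrite mulr_ge0 ?a0 // ltW.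
pose B t : \bar R := (\sum_(j <oo) (z j t `^ p)%:E)%E.
have u0 j t : (0 <= (z j t `^ p)%:E)%E by rewrite lee_fin powR_ge0.
have B0 t : (0 <= B t)%E by apply: nneseries_ge0 => j _ _.
have Bm : measurable_fun S B.
  by apply: (@ge0_emeasurable_sum _ _ _ _ _ xpredT) => j *; [exact: u0|exact: mpow].
(* The j-th integral is at most [(2^j 4^-j)^p], and this is at most [2^-j] because [p >= 1]. *)
have IB : (\int[mu]_(t in S) B t <= 2%:E)%E.
  rewrite integral_nneseries //; last by move=> j; exact: mpow.
  apply: lime_le; first by apply: is_cvg_nneseries => j _ _; exact: powint_ge0.
  apply: nearW => n; apply: (@le_trans _ _ (\sum_(0 <= j < n) (2^-1 ^+ j)%:E)%E).
    apply: lee_sum => j _; rewrite -powintE powintZ ?(ltW (w0 j)) //; last exact: a0.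
    rewrite (powint_pnorm (afin j)) -EFinM lee_fin -powRM ?(ltW (w0 j)) ?pnorm_ge0 //.
    have le2 : w j * pnorm (a j) <= 2^-1 ^+ j.
      apply: le_trans (ler_wpM2l (ltW (w0 j)) (y4 j)) _.
      by rewrite /w -exprMn; have -> : 2 * 4^-1 = 2^-1 :> R by lra.
    apply: (@le_trans _ _ ((2^-1 ^+ j) `^ p)).
      by rewrite ge0_ler_powR ?nnegrE ?mulr_ge0 ?(ltW (w0 j)) ?pnorm_ge0 ?exprn_ge0.
    rewrite -[leRHS]powRr1 ?exprn_ge0 //; apply: ger_powR => //.
    by rewrite exprn_gt0 //= exprn_ile1 //; lra.
  rewrite sumEFin lee_fin.
  suff -> : \sum_(0 <= j < n) 2^-1 ^+ j = 2 - 2 * 2^-1 ^+ n :> R.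
    by rewrite lerBlDr lerDl mulr_ge0 // exprn_ge0.
  elim: n => [|n IH]; first by rewrite big_nil expr0; ring.
  by rewrite big_nat_recr //= IH exprS; field.
pose b t := fine (B t) `^ p^-1.
(* One term of a nonnegative series is at most its sum; then p-th roots are taken. *)
have ab j t : S t -> (B t < +oo)%E -> a j t <= b t * 2^-1 ^+ j.
  move=> St Bt; rewrite exprVn ler_pdivlMr ?exprn_gt0 // mulrC -/(w j) -/(z j t).
  rewrite -(pVp (z0 j t St)) ge0_ler_powR ?nnegrE ?invr_ge0 ?powR_ge0 ?fine_ge0 //.
  rewrite -lee_fin fineK ?ge0_fin_numE //.
  apply: le_trans (nneseries_lim_ge j.+1 (fun j _ _ => u0 j t)).
  by rewrite big_nat_recr //= leeDr // sume_ge0.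
pose s := @partial_sum R Lebesgue_space y.
have ps n t : s n t = @partial_sum R (RF_space R) (y^~ t) n by elim: n => //= n ->.
have Ls n : Lebesgue_mem (s n) := partial_sum_in Lebesgue_metric_cone n Ly.
have fy j t : S t -> is_fuzzy (y j t) by have [+ _ _] := Ly j; exact.
have fs n t : S t -> is_fuzzy (s n t) by have [+ _ _] := Ls n; exact.
(* Where [B] is infinite the limit is set to zero, on a measurable set, so that [x] remains
   measurable. *)
have ex t : exists v, S t -> is_fuzzy v /\
    if (B t < +oo)%E then forall n, Dist (s n t) v <= 2 * (b t * 2^-1 ^+ n) else v = @fzero R.
  have [St|nSt] := pselect (S t); last by exists (@fzero R).
  have [Bt|Bt] := boolP (B t < +oo)%E; last by exists (@fzero R).
  have c0 n : 0 <= b t * 2^-1 ^+ n by rewrite mulr_ge0 ?powR_ge0 ?exprn_ge0.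
  have cS n : b t * 2^-1 ^+ n.+1 <= b t * 2^-1 ^+ n / 2 by rewrite exprSr mulrA.
  have fyt j := fy j t St; have abt j := ab j t St Bt.
  have cauchy := partial_sum_cauchy (@RF_metric_cone R) fyt abt c0 cS.
  have fst n : is_fuzzy (@partial_sum R (RF_space R) (y^~ t) n) by rewrite -ps; exact: fs.
  have [|v fv cv] := fuzzy_complete fst.
    move=> e e0; have [N HN] := @geometric_small R 2^-1 (4 * b t) e ltac:(lra) e0.
    exists N => n m Nn Nm.
    have H j : (N <= j)%N -> Dist (@partial_sum R (RF_space R) (y^~ t) N)
        (@partial_sum R (RF_space R) (y^~ t) j) <= 2 * (b t * 2^-1 ^+ N).
      by move=> Nk; rewrite -(subnKC Nk); exact: cauchy.
    apply: le_trans (Dist_tri (fst n) (fst N) (fst m)) _; rewrite Dist_sym.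
    by have := H n Nn; have := H m Nm; have := HN N (leqnn N); lra.
  exists v => _; split=> // n; rewrite ps.
  exact: (partial_sum_tail (@RF_metric_cone R) fyt fv abt c0 cS cv).
have [x Hx] := choice ex.
have fx t : S t -> is_fuzzy (x t) by move=> /Hx[].
have mx : level_measurable x.
  have mG : measurable_fun S (fun t => (B t < +oo)%E).
    apply: (measurable_fun_bool true).
    by rewrite (_ : _ @^-1` _ = [set t | (B t < +oo)%E]) //; exact: emeasurable_fun_infty_o.
  (* [q] is [lower] or [upper]: [q (x t) r] is the pointwise limit of [q (s n t) r] cut to 0 where
     [B] is infinite. *)
  have lim (q : (R -> R) -> R -> R) : (forall u v r, is_fuzzy u -> is_fuzzy v -> 0 <= r <= 1 ->
      `|q u r - q v r| <= Dist u v) -> (forall r, 0 <= r <= 1 -> q (@fzero R) r = 0) ->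
    forall r, 0 <= r <= 1 -> (forall n, measurable_fun S (fun t => q (s n t) r)) ->
    measurable_fun S (fun t => q (x t) r).
    move=> qD q0 r r01 ms.
    apply: (@measurable_fun_cvg _ _ _ _ (fun n t => if (B t < +oo)%E then q (s n t) r else 0)).
      move=> n; apply: measurable_fun_if => //; first by apply: measurable_funS (ms n) => //; exact: subIsetl.
    move=> t St; have [fxt] := Hx t St; case: ifPn => Bt H; last by rewrite H q0 //; exact: cvg_cst.
    apply/cvgrPdist_le => e e0.
    have [N HN] := @geometric_small R 2^-1 (2 * b t) e ltac:(lra) e0.
    exists N => // n /= Nn; rewrite distrC.
    apply: le_trans (qD _ _ _ (fs n t St) fxt r01) (le_trans (H n) _).
    by rewrite mulrA; exact: HN.
  move=> r r01; split.
    apply: (lim _ _ _ r r01 _) => [u v q fu fv q01||n]; first by have [] := Dist_ge fu fv q01.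
      exact: lower0.
    by have [_ + _] := Ls n => /(_ r r01)[].
  apply: (lim _ _ _ r r01 _) => [u v q fu fv q01||n]; first by have [] := Dist_ge fu fv q01.
    exact: upper0.
  by have [_ + _] := Ls n => /(_ r r01)[].
have Dm n : measurable_fun S (fun t => Dist (s n t) (x t)).
  by have [fsn msn _] := Ls n; exact: measurable_Dist.
(* Where the series B diverges the bound below is infinite, so no almost
   everywhere argument is needed. *)
have key n : (powint (fun t => Dist (s n t) (x t)) <= ((4 * 2^-1 ^+ n) `^ p)%:E)%E.
  pose c : R := (2 * 2^-1 ^+ n) `^ p.
  have cpos : 0 < c by rewrite powR_gt0 // mulr_gt0 // exprn_gt0.
  apply: (@le_trans _ _ (\int[mu]_(t in S) (c%:E * B t))%E).
    rewrite powintE; apply: ge0_le_integral => //.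
    - by move=> t _; rewrite lee_fin powR_ge0.
    - exact: mpow.
    - by apply: emeasurable_funM => //; exact: measurable_cst.
    - move=> t St; have [fxt] := Hx t St; case: ifPn => Bt H; last first.
        by move: Bt; rewrite -leNgt leye_eq => /eqP ->; rewrite gt0_muley ?leey // lte_fin.
      rewrite -[B t]fineK ?ge0_fin_numE // -EFinM lee_fin.
      have bE : b t `^ p = fine (B t) by rewrite /b -powRrM mulVf // powRr1 ?fine_ge0.
      rewrite -bE -powRM ?powR_ge0 ?mulr_ge0 ?exprn_ge0 //.
      have le : Dist (s n t) (x t) <= 2 * 2^-1 ^+ n * b t.
        by apply: le_trans (H n) _; rewrite -mulrA (mulrC (b t)).
      have D0 : 0 <= Dist (s n t) (x t) := Dist_ge0 (fs n t St) fxt.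
      by apply: (ge0_ler_powR p0 _ _ le); rewrite nnegrE // (le_trans D0 le).
  rewrite ge0_integralZl_EFin ?(ltW cpos) //.
  apply: le_trans (lee_wpmul2l _ IB) _; first by rewrite lee_fin ltW.
  rewrite -EFinM lee_fin.
  (* The 4 is the 2 of the pointwise rate times a 2 that absorbs the integral of [B], since
     [2 <= 2^p]. *)
  have -> : 4 * 2^-1 ^+ n = (2 * 2^-1 ^+ n) * 2 :> R by ring.
  rewrite [leRHS]powRM ?mulr_ge0 ?exprn_ge0 // ler_pM2l //.
  by rewrite -[leLHS]powRr1 // ler_powR //; lra.
(* The partial sum of rank 0 is zero, so the error bound at rank 0 is the integrability of [x]. *)
have Lx : Lebesgue_mem x.
  split=> //; apply: (@le_lt_trans _ _ (powint (fun t => Dist (s 0%N t) (x t)))).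
    by rewrite le_eqVlt; apply/orP; left; apply/eqP/eq_powint => t _; rewrite Dist_sym.
  by apply: le_lt_trans (key 0%N) _; rewrite ltry.
exists x => // e e0.
have [N HN] := @geometric_small R 2^-1 4 e ltac:(lra) e0.
exists N => n Nn; apply: le_trans (HN n Nn).
by apply: pnorm_le_powint; [rewrite mulr_ge0 ?exprn_ge0|exact: key].
Qed.

End Lp.
End LebesgueSpaces.

(** * Hukuhara derivatives *)

Section HukuharaDerivative.
Variable R : realType.
Implicit Types (u v w z : R -> R) (f g : R -> R -> R).

(** The Hukuhara difference is unique when it exists; translation invariance replaces
    subtraction. *)
Lemma faddI u z z' : is_fuzzy u -> is_fuzzy z -> is_fuzzy z' ->
  fadd u z = fadd u z' -> z = z'.
Proof.
move=> fu fz fz' E; apply: Dist_eq0 => //.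
by rewrite -(DistDl fu fz fz') E Dist_refl //; exact: fuzzyD.
Qed.

Lemma Dist_scaled_quotient h z w : 0 < h -> is_fuzzy z -> is_fuzzy w ->
  Dist z (fsmul h w) = h * Dist (fsmul h^-1 z) w.
Proof.
move=> h0 fz fw; have hV : 0 <= h^-1 by rewrite invr_ge0 ltW.
rewrite -(DistZ (ltW h0) (fuzzyZ hV fz) fw) (fsmulA (ltW h0) hV fz).
by rewrite mulfV ?gt_eqF // fsmul1.
Qed.

(** The Hukuhara difference of the later value [v] and the earlier value [u] exists, and its
    quotient by [h] is within [e] of [w]. Left and right quotients both have this form. *)
Definition quotient_near u v h w (e : R) : Prop :=
  exists2 z, is_fuzzy z & v = fadd u z /\ Dist (fsmul h^-1 z) w < e.

Lemma quotient_nearD h u v w e u' v' w' e' : 0 < h ->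
  is_fuzzy u -> is_fuzzy w -> is_fuzzy u' -> is_fuzzy w' ->
  quotient_near u v h w e -> quotient_near u' v' h w' e' ->
  quotient_near (fadd u u') (fadd v v') h (fadd w w') (e + e').
Proof.
move=> h0 fu fw fu' fw' [z fz [-> ze]] [z' fz' [-> ze']].
have hV : 0 <= h^-1 by rewrite invr_ge0 ltW.
exists (fadd z z'); first exact: fuzzyD.
split; first exact: faddACA.
rewrite fsmulDr //; apply: le_lt_trans (ltrD ze ze').
exact: (DistD (fuzzyZ hV fz) (fuzzyZ hV fz') fw fw').
Qed.

(** The factor [l + 1] instead of [l] keeps the inequality strict when [l = 0]. *)
Lemma quotient_nearZ l h u v w e : 0 <= l -> 0 < h -> is_fuzzy u -> is_fuzzy w ->
  quotient_near u v h w e -> quotient_near (fsmul l u) (fsmul l v) h (fsmul l w) ((l + 1) * e).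
Proof.
move=> l0 h0 fu fw [z fz [-> ze]]; have hV : 0 <= h^-1 by rewrite invr_ge0 ltW.
have fhz := fuzzyZ hV fz.
exists (fsmul l z); first exact: fuzzyZ.
split; first exact: fsmulDr.
rewrite (fsmulA hV l0 fz) mulrC -(fsmulA l0 hV fz) DistZ //.
by have := Dist_ge0 fhz fw; nra.
Qed.

Lemma quotient_near_unique h u v w w' e e' : 0 < h ->
  is_fuzzy u -> is_fuzzy w -> is_fuzzy w' ->
  quotient_near u v h w e -> quotient_near u v h w' e' -> Dist w w' < e + e'.
Proof.
move=> h0 fu fw fw' [z fz [-> ze]] [z' fz' [E ze']].
have zz : z = z' by exact: (faddI fu fz fz' E).
have hV : 0 <= h^-1 by rewrite invr_ge0 ltW.
apply: le_lt_trans (Dist_tri fw (fuzzyZ hV fz) fw') _.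
by rewrite Dist_sym {2}zz; exact: ltrD.
Qed.

Variables a b : R.
Hypothesis ab : a < b.

Definition fuzzy_on f := forall t, a <= t <= b -> is_fuzzy (f t).

(** Both sides share one radius, and the end points need no separate case: there [t + h <= b] or
    [a <= t - h] is impossible for [h > 0]. *)
Lemma Hderiv_atP f t w : Hderiv_at a b f t w <->
  forall e, 0 < e -> exists2 d, 0 < d & forall h, 0 < h < d ->
    (t + h <= b -> quotient_near (f t) (f (t + h)) h w e) /\
    (a <= t - h -> quotient_near (f (t - h)) (f t) h w e).
Proof.
split=> [[Hr Hl] e e0|H].
  have [dr dr0 Hdr] : exists2 d, 0 < d & forall h, 0 < h < d ->
      t + h <= b -> quotient_near (f t) (f (t + h)) h w e.
    have [tb|bt] := ltP t b; first exact: Hr.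
    by exists 1 => // h; lra.
  have [dl dl0 Hdl] : exists2 d, 0 < d & forall h, 0 < h < d ->
      a <= t - h -> quotient_near (f (t - h)) (f t) h w e.
    have [at_|ta] := ltP a t; first exact: Hl.
    by exists 1 => // h; lra.
  exists (Num.min dr dl); first by rewrite lt_min dr0.
  move=> h; rewrite lt_min => /and3P[h0 hr hl].
  by split; [apply: Hdr; rewrite h0|apply: Hdl; rewrite h0].
by split=> _ e /H[d d0 Hd]; exists d => // h /Hd[].
Qed.

Lemma eq_Hderiv_at f g t w : (forall s, a <= s <= b -> f s = g s) -> a <= t <= b ->
  Hderiv_at a b f t w -> Hderiv_at a b g t w.
Proof.
move=> fg tab /Hderiv_atP H; apply/Hderiv_atP => e /H[d d0 Hd]; exists d => // h hd.
have [Hr Hl] := Hd h hd; split=> th.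
  by rewrite -(fg t tab) -fg; [exact: Hr|lra].
by rewrite -(fg t tab) -fg; [exact: Hl|lra].
Qed.

Lemma Hderiv_at_unique f t w w' : fuzzy_on f -> is_fuzzy w -> is_fuzzy w' -> a <= t <= b ->
  Hderiv_at a b f t w -> Hderiv_at a b f t w' -> w = w'.
Proof.
move=> ff fw fw' tab /Hderiv_atP H /Hderiv_atP H'; apply: Dist_eq0 => //.
apply/ler_addgt0Pr => e e0; rewrite add0r.
have [d d0 Hd] := H (e / 2) ltac:(lra); have [d' d0' Hd'] := H' (e / 2) ltac:(lra).
(* As [h <= (b - a) / 2], at least one of [t + h] and [t - h] lies in the segment. *)
pose h := Num.min (Num.min d d') (b - a) / 2.
have m0 : 0 < Num.min (Num.min d d') (b - a) by rewrite !lt_min d0 d0' subr_gt0.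
have hdd : Num.min (Num.min d d') (b - a) <= Num.min d d' by rewrite ge_min lexx.
have hab : Num.min (Num.min d d') (b - a) <= b - a by rewrite ge_min lexx orbT.
have hd : Num.min d d' <= d by rewrite ge_min lexx.
have hd' : Num.min d d' <= d' by rewrite ge_min lexx orbT.
have h0 : 0 < h by rewrite /h; lra.
have [Hr Hl] := Hd h ltac:(rewrite /h; lra); have [Hr' Hl'] := Hd' h ltac:(rewrite /h; lra).
have -> : e = e / 2 + e / 2 by lra.
apply: ltW; have [thb|bth] := leP (t + h) b.
  exact: (quotient_near_unique h0 (ff t tab) fw fw' (Hr thb) (Hr' thb)).
have ath : a <= t - h by rewrite /h in bth *; lra.
have tab' : a <= t - h <= b by move: ath h0; lra.
exact: (quotient_near_unique h0 (ff _ tab') fw fw' (Hl ath) (Hl' ath)).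
Qed.

Lemma Hderiv_atD f g t w w' : fuzzy_on f -> fuzzy_on g -> is_fuzzy w -> is_fuzzy w' ->
  a <= t <= b -> Hderiv_at a b f t w -> Hderiv_at a b g t w' ->
  Hderiv_at a b (fun s => fadd (f s) (g s)) t (fadd w w').
Proof.
move=> ff fg fw fw' tab /Hderiv_atP H /Hderiv_atP H'; apply/Hderiv_atP => e e0.
have [d d0 Hd] := H (e / 2) ltac:(lra); have [d' d0' Hd'] := H' (e / 2) ltac:(lra).
exists (Num.min d d'); first by rewrite lt_min d0.
move=> h; rewrite lt_min => /and3P[h0 hd hd'].
have [Hr Hl] := Hd h ltac:(rewrite h0; exact: hd).
have [Hr' Hl'] := Hd' h ltac:(rewrite h0; exact: hd').
have -> : e = e / 2 + e / 2 by lra.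
split=> th.
  exact: (quotient_nearD h0 (ff t tab) fw (fg t tab) fw' (Hr th) (Hr' th)).
have tab' : a <= t - h <= b by lra.
exact: (quotient_nearD h0 (ff _ tab') fw (fg _ tab') fw' (Hl th) (Hl' th)).
Qed.

Lemma Hderiv_atZ l f t w : 0 <= l -> fuzzy_on f -> is_fuzzy w -> a <= t <= b ->
  Hderiv_at a b f t w -> Hderiv_at a b (fun s => fsmul l (f s)) t (fsmul l w).
Proof.
move=> l0 ff fw tab /Hderiv_atP H; apply/Hderiv_atP => e e0.
have l1 : 0 < l + 1 by lra.
have [d d0 Hd] := H (e / (l + 1)) (divr_gt0 e0 l1).
exists d => // h hd; have h0 : 0 < h by lra.
have [Hr Hl] := Hd h hd.
have -> : e = (l + 1) * (e / (l + 1)) by rewrite mulrC divfK // gt_eqF.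
split=> th; first exact: (quotient_nearZ l0 h0 (ff t tab) fw (Hr th)).
have tab' : a <= t - h <= b by lra.
exact: (quotient_nearZ l0 h0 (ff _ tab') fw (Hl th)).
Qed.

Lemma Hderiv_at0 t : Hderiv_at a b (fun=> @fzero R) t (@fzero R).
Proof.
have f0 := @fuzzy0 R; apply/Hderiv_atP => e e0; exists 1 => // h h01.
suff Q : quotient_near (@fzero R) (@fzero R) h (@fzero R) e by [].
exists (@fzero R) => //; rewrite fadd0 // fsmul0 ?Dist_refl //.
by rewrite invr_ge0; lra.
Qed.

Lemma Hderiv_spec f t : Hdiff_on a b f -> a <= t <= b ->
  is_fuzzy (Hderiv a b f t) /\ Hderiv_at a b f t (Hderiv a b f t).
Proof.
move=> df tab; have [w fw Hw] := df t tab.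
by apply: (ClassicalEpsilon.epsilon_spec (inhabits (@fzero R)) (fun w => is_fuzzy w /\ Hderiv_at a b f t w)); exists w.
Qed.

Lemma Hderiv_eq f t w : fuzzy_on f -> is_fuzzy w -> a <= t <= b ->
  Hderiv_at a b f t w -> Hderiv a b f t = w.
Proof.
move=> ff fw tab Hw.
have [fd Hd] : is_fuzzy (Hderiv a b f t) /\ Hderiv_at a b f t (Hderiv a b f t).
  by apply: (ClassicalEpsilon.epsilon_spec (inhabits (@fzero R)) (fun w => is_fuzzy w /\ Hderiv_at a b f t w)); exists w.
exact: (Hderiv_at_unique ff fd fw tab Hd Hw).
Qed.

(* The Hukuhara difference [f s - f t] is only known to exist for [s] close to
   [t]; real induction glues the local differences along [[t, s]]. *)
Lemma Hukuhara_mean_value f t s w K : fuzzy_on f -> is_fuzzy w ->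
  a <= t -> t <= s -> s <= b ->
  (forall r, t <= r <= s -> exists2 v, is_fuzzy v & Hderiv_at a b f r v /\ Dist v w <= K) ->
  exists2 z, is_fuzzy z & f s = fadd (f t) z /\ Dist z (fsmul (s - t) w) <= (s - t) * K.
Proof.
move=> ff fw at_ ts sb df; have f0 := @fuzzy0 R.
have tab : a <= t <= b by lra.
(* The slack [e] per unit length is needed because a local quotient is only close to the derivative;
   it is removed at the end. *)
pose P e r := exists2 z, is_fuzzy z &
  f r = fadd (f t) z /\ Dist z (fsmul (r - t) w) <= (r - t) * (K + e).
have step e r h v : t <= r -> 0 < h -> is_fuzzy v -> Dist v w <= K ->
    quotient_near (f r) (f (r + h)) h v e -> P e r -> P e (r + h).
  move=> tr h0 fv vK [z' fz' [E' ze']] [z fz [E zK]].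
  exists (fadd z z'); first exact: fuzzyD.
  split; first by rewrite E' E faddA //; exact: (ff t tab).
  have rt : 0 <= r - t by lra.
  have -> : r + h - t = (r - t) + h by lra.
  rewrite (fsmulDl rt (ltW h0) fw).
  have frw := fuzzyZ rt fw; have fhw := fuzzyZ (ltW h0) fw.
  apply: le_trans (DistD fz fz' frw fhw) _; rewrite mulrDl; apply: lerD => //.
  have hV : 0 <= h^-1 by rewrite invr_ge0 ltW.
  rewrite Dist_scaled_quotient // ler_pM2l //.
  by have := Dist_tri (fuzzyZ hV fz') fv fw; lra.
have PH e : 0 < e -> forall r, t <= r <= s -> P e r.
  move=> e0; apply: real_induction.
  - exists (@fzero R) => //; rewrite fadd0 ?subrr; last exact: ff.
    by rewrite /fsmul eqxx Dist_refl // mul0r.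
  - move=> r rts /(_ r ltac:(lra)) Pr.
    have [v fv [/Hderiv_atP/(_ e e0)[d d0 Hd] vK]] := df r ltac:(lra).
    exists d => // q rq qs; have -> : q = r + (q - r) by lra.
    apply: step Pr => //; [lra|lra|exact: fv|exact: vK|].
    by have [+ _] := Hd (q - r) ltac:(lra); apply; lra.
  - move=> r tr H.
    have [v fv [/Hderiv_atP/(_ e e0)[d d0 Hd] vK]] := df r ltac:(lra).
    (* A step back from [r], short enough for the left quotient at [r] and for staying in [[t, r)],
       where the property is known. *)
    pose h := Num.min (d / 2) (r - t).
    have h0 : 0 < h by rewrite lt_min; lra.
    have hd : h <= d / 2 by rewrite ge_min lexx.
    have hr : h <= r - t by rewrite ge_min lexx orbT.
    have rE : r = (r - h) + h by lra.
    rewrite rE; apply: step (H (r - h) _) => //; [lra|exact: fv|exact: vK| |lra].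
    by rewrite -rE; have [_ +] := Hd h ltac:(lra); apply; lra.
(* By cancellation the difference is the same for every slack, so the slack can tend to 0; dividing
   it by [s - t + 1] also covers [s = t]. *)
have [z fz [fz1 _]] := PH 1 ltr01 s ltac:(lra).
exists z => //; split=> //; apply/ler_addgt0Pr => e e0.
have [z' fz' [fz1' zK]] : P (e / (s - t + 1)) s.
  by apply: PH; [rewrite divr_gt0 //|]; lra.
have -> : z = z' by apply: (faddI (ff t tab)) => //; rewrite -fz1.
apply: le_trans zK _; rewrite mulrDr lerD2l mulrA ler_pdivrMr; last lra.
by nra.
Qed.

(** The difference of [f] over [[p, p + h]] has to be produced. The mean value inequality gives
    differences [z_n] of the [F n] within [h e / 2] of [h g(t)]. They form a Cauchy sequence because
    the [F n] converge at both ends, and their limit is a difference of [f] with the same bound. *)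
Lemma limit_Hderiv_at (F G : nat -> R -> R -> R) f g : fuzzy_on f -> C_mem a b g ->
  (forall n, fuzzy_on (F n)) -> (forall n, fuzzy_on (G n)) ->
  (forall n t, a <= t <= b -> Hderiv_at a b (F n) t (G n t)) ->
  (forall e, 0 < e -> exists N, forall n, (N <= n)%N -> forall t, a <= t <= b -> Dist (F n t) (f t) <= e) ->
  (forall e, 0 < e -> exists N, forall n, (N <= n)%N -> forall t, a <= t <= b -> Dist (G n t) (g t) <= e) ->
  forall t, a <= t <= b -> Hderiv_at a b f t (g t).
Proof.
move=> ff [fg cg] fF fG dF cvF cvG t tab; apply/Hderiv_atP => e e0.
have [d d0 Hd] := cg t tab (e / 4) ltac:(lra).
have [N HN] := cvG (e / 4) ltac:(lra).
(* [p = t] gives the right quotient, [p = t - h] the left one. *)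
suff key p h : 0 < h < d -> a <= p -> p + h <= b -> p <= t <= p + h ->
    quotient_near (f p) (f (p + h)) h (g t) e.
  exists d => // h hd; split=> th; first by apply: key => //; lra.
  have {2}-> : t = t - h + h by lra.
  by apply: key => //; lra.
move=> hd ap phb pt; have h0 : 0 < h by lra.
have gt := fg t tab; have pab : a <= p <= b by lra.
have qab : a <= p + h <= b by lra.
have ex (n : nat) : exists z : R -> R, is_fuzzy z /\ (F (N + n)%N (p + h) = fadd (F (N + n)%N p) z /\
    Dist z (fsmul h (g t)) <= h * (e / 2)).
  have [||||||z fz [E zK]] := @Hukuhara_mean_value (F (N + n)%N) p (p + h) (g t) (e / 2).
  - exact: fF.
  - by [].
  - by [].
  - lra.
  - by [].
  - move=> r rp; have rab : a <= r <= b by lra.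
    exists (G (N + n)%N r); first exact: fG.
    split; first exact: dF.
    apply: le_trans (Dist_tri (fG _ r rab) (fg r rab) gt) _.
    have := HN (N + n)%N (leq_addr _ _) r rab.
    by have := Hd r rab ltac:(rewrite ltr_norml; lra); lra.
  by exists z; split=> //; split=> //; move: zK; have -> : p + h - p = h by lra.
have [z Hz] := choice ex.
have fz n : is_fuzzy (z n) by have [] := Hz n.
have [|zl fzl cvz] := fuzzy_complete fz.
  move=> r r0; have [M HM] := cvF (r / 4) ltac:(lra); exists M => n m Mn Mm.
  have HMn s (sab : a <= s <= b) := HM (N + n)%N (leq_trans Mn (leq_addl _ _)) s sab.
  have HMm s (sab : a <= s <= b) := HM (N + m)%N (leq_trans Mm (leq_addl _ _)) s sab.
  have Fn s (sab : a <= s <= b) := fF (N + n)%N s sab.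
  have Fm s (sab : a <= s <= b) := fF (N + m)%N s sab.
  (* Translating by [F_n(p)] replaces [z_n] by [F_n(p + h)]; four errors remain, those of [F_n] and
     [F_m] at [p] and [p + h]. *)
  rewrite -(DistDl (Fn p pab) (fz n) (fz m)).
  have [_ [<- _]] := Hz n; have [_ [E _]] := Hz m.
  apply: le_trans (Dist_tri (Fn _ qab) (Fm _ qab) (fuzzyD (Fn p pab) (fz m))) _.
  rewrite {2}E.
  have := DistD (Fm p pab) (fz m) (Fn p pab) (fz m); rewrite (Dist_refl (fz m)).
  have := Dist_tri (Fn _ qab) (ff _ qab) (Fm _ qab).
  have := Dist_tri (Fm _ pab) (ff _ pab) (Fn _ pab).
  rewrite (Dist_sym (f (p + h))) (Dist_sym (f p)).
  have := HMn _ qab; have := HMm _ qab; have := HMn _ pab; have := HMm _ pab; lra.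
have fhg := fuzzyZ (ltW h0) gt.
exists zl => //; split.
  apply: Dist_eq0; [exact: ff|by apply: fuzzyD => //; exact: ff|].
  apply/ler_addgt0Pr => r r0; rewrite add0r.
  have [M HM] := cvF (r / 3) ltac:(lra); have [M' HM'] := cvz (r / 3) ltac:(lra).
  pose n := maxn M M'.
  have Fn s (sab : a <= s <= b) := fF (N + n)%N s sab.
  have HMn s (sab : a <= s <= b) := HM (N + n)%N (leq_trans (leq_maxl _ _) (leq_addl _ _)) s sab.
  have HMz := HM' n (leq_maxr _ _).
  apply: le_trans (Dist_tri (ff _ qab) (Fn _ qab) (fuzzyD (ff _ pab) fzl)) _.
  have [_ [E _]] := Hz n; rewrite {2}E (Dist_sym (f (p + h))).
  have := DistD (Fn _ pab) (fz n) (ff _ pab) fzl.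
  have := HMn _ qab; have := HMn _ pab; lra.
have zle : Dist zl (fsmul h (g t)) <= h * (e / 2).
  apply/ler_addgt0Pr => r r0; have [M HM] := cvz r r0.
  have [_ [_ zK]] := Hz M.
  apply: le_trans (Dist_tri fzl (fz M) fhg) _; rewrite addrC (Dist_sym zl).
  by apply: lerD => //; exact: HM.
move: zle; rewrite Dist_scaled_quotient // ler_pM2l // => /le_lt_trans; apply; lra.
Qed.

(** * The spaces C^p *)

Lemma eq_C_mem f g : (forall t, a <= t <= b -> f t = g t) -> C_mem a b f -> C_mem a b g.
Proof.
move=> fg [ff cf]; split=> [t tab|t tab e e0]; first by rewrite -fg //; exact: ff.
have [d d0 Hd] := cf t tab e e0; exists d => // s sab st.
by rewrite -!fg //; exact: Hd.
Qed.

(** Iterated derivatives are chosen by [epsilon] and cannot be computed directly. Exhibiting a tower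
    in which each function is differentiated by the next gives both membership and the values, by
    uniqueness of derivatives on the segment. *)
Lemma Cp_char p f (F : nat -> R -> R -> R) : (forall t, a <= t <= b -> F 0%N t = f t) ->
  (forall i, (i <= p)%N -> C_mem a b (F i)) ->
  (forall i, (i < p)%N -> forall t, a <= t <= b -> Hderiv_at a b (F i) t (F i.+1 t)) ->
  Cp_mem a b p f /\
  forall i, (i <= p)%N -> forall t, a <= t <= b -> nderiv a b i f t = F i t.
Proof.
move=> F0 CF dF.
have E i : (i <= p)%N -> forall t, a <= t <= b -> nderiv a b i f t = F i t.
  elim: i => [_ t tab|i IH ip t tab]; first by rewrite F0.
  have EF s : a <= s <= b -> F i s = nderiv a b i f s by move=> sab; rewrite IH // ltnW.
  rewrite /nderiv iterS -/(nderiv a b i f); apply: Hderiv_eq => //.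
  - by move=> s sab; rewrite -EF //; have [+ _] := CF i (ltnW ip); apply.
  - by have [+ _] := CF i.+1 ip; apply.
  - exact: (eq_Hderiv_at EF tab (dF i ip t tab)).
split=> // i ip; split.
  by apply: eq_C_mem (CF i ip) => t tab; rewrite E.
move=> ip1 t tab; exists (F i.+1 t); first by have [+ _] := CF i.+1 ip1; apply.
by apply: eq_Hderiv_at (dF i ip1 t tab) => // s sab; rewrite E.
Qed.

Section Cp.
Variable p : nat.
Local Notation nd := (nderiv a b).

Let CF := C_family ab.
Let CM : metric_cone (C_space a b) := sup_metric_cone CF.

Lemma Cp_nderiv_at f i t : Cp_mem a b p f -> (i < p)%N -> a <= t <= b ->
  Hderiv_at a b (nd i f) t (nd i.+1 f t).
Proof. by move=> /(_ i) mf ip tab; have [_ /(_ ip) df] := mf (ltnW ip); have [] := Hderiv_spec df tab. Qed.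

Lemma Cp_zero : Cp_mem a b p (@fpzero R) /\
  forall i, (i <= p)%N -> forall t, a <= t <= b -> nd i (@fpzero R) t = @fzero R.
Proof.
apply: (@Cp_char _ _ (fun=> fun=> @fzero R)) => // [i _|i _ t tab].
  exact: (sup_zero CF).
exact: Hderiv_at0.
Qed.

Lemma Cp_add f g : Cp_mem a b p f -> Cp_mem a b p g -> Cp_mem a b p (fpadd f g) /\
  forall i, (i <= p)%N -> forall t, a <= t <= b -> nd i (fpadd f g) t = fadd (nd i f t) (nd i g t).
Proof.
move=> mf mg; apply: (@Cp_char _ _ (fun i t => fadd (nd i f t) (nd i g t))) => // [i ip|i ip t tab].
  exact: (sup_add CF (mf i ip).1 (mg i ip).1).
have [[ff _] _] := mf i (ltnW ip); have [[fg _] _] := mg i (ltnW ip).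
have [[ff' _] _] := mf i.+1 ip; have [[fg' _] _] := mg i.+1 ip.
by apply: Hderiv_atD => //; [exact: ff'|exact: fg'|exact: Cp_nderiv_at|exact: Cp_nderiv_at].
Qed.

Lemma Cp_smul l f : 0 <= l -> Cp_mem a b p f -> Cp_mem a b p (fpsmul l f) /\
  forall i, (i <= p)%N -> forall t, a <= t <= b -> nd i (fpsmul l f) t = fsmul l (nd i f t).
Proof.
move=> l0 mf; apply: (@Cp_char _ _ (fun i t => fsmul l (nd i f t))) => // [i ip|i ip t tab].
  exact: (sup_smul CF l0 (mf i ip).1).
have [[ff _] _] := mf i (ltnW ip); have [[ff' _] _] := mf i.+1 ip.
by apply: Hderiv_atZ => //; [exact: ff'|exact: Cp_nderiv_at].
Qed.

Lemma eq_Cdist f g f' g' : (forall t, a <= t <= b -> f t = f' t) ->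
  (forall t, a <= t <= b -> g t = g' t) -> Cdist a b f g = Cdist a b f' g'.
Proof.
move=> ff gg; apply: (@supD_eq R R [set t | a <= t <= b] (C_mem a b)) => t tab.
by rewrite ff // gg.
Qed.

Let mem_ord f (i : 'I_p.+1) : Cp_mem a b p f -> C_mem a b (nd i f).
Proof. by move=> mf; exact: (mf i (ltn_ord i)).1. Qed.

Lemma Cp_snorm f : Cp_mem a b p f ->
  @snorm R (Cp_space a b p) f = \sum_(i < p.+1) @snorm R (C_space a b) (nd i f).
Proof.
move=> mf; apply: eq_bigr => i _; apply: eq_Cdist => // t tab.
exact: (Cp_zero.2 i (ltn_ord i) t tab).
Qed.

Lemma Cp_metric_cone : metric_cone (Cp_space a b p).
Proof.
split=> /=.
- by have [] := Cp_zero.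
- by move=> f g mf mg; have [] := Cp_add mf mg.
- by move=> l f l0 mf; have [] := Cp_smul l0 mf.
- by move=> f g mf mg; apply: sumr_ge0 => i _; apply: (cone_ge0 CM); exact: mem_ord.
- by move=> f g mf mg; apply: eq_bigr => i _; apply: (cone_sym CM); exact: mem_ord.
- move=> f g h mf mg mh; rewrite /Cpdist -big_split /=; apply: ler_sum => i _.
  by apply: (cone_tri CM); exact: mem_ord.
- move=> f g mf mg; rewrite [RHS](Cp_snorm mg); apply: eq_bigr => i _.
  rewrite -(cone_addl CM (mem_ord i mf) (mem_ord i mg)); apply: eq_Cdist => // t tab.
  exact: ((Cp_add mf mg).2 i (ltn_ord i) t tab).
- move=> l f l0 mf; have [mlf E] := Cp_smul l0 mf.
  rewrite [LHS](Cp_snorm mlf) [X in _ * X](Cp_snorm mf) mulr_sumr; apply: eq_bigr => i _.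
  rewrite -(cone_norm_smul CM l0 (mem_ord i mf)); apply: eq_Cdist => // t tab.
  exact: (E i (ltn_ord i) t tab).
Qed.

Lemma Cp_series_complete : series_complete (Cp_space a b p).
Proof.
move=> y my y4.
pose s := @partial_sum R (Cp_space a b p) y.
have ms n : Cp_mem a b p (s n) := partial_sum_in Cp_metric_cone n my.
(* Differentiation commutes with partial sums, on the segment only. *)
have sE i n t : (i <= p)%N -> a <= t <= b ->
    nd i (s n) t = @partial_sum R (C_space a b) (fun n => nd i (y n)) n t.
  move=> ip tab; elim: n => [|n IH]; first by have [_ ->] := Cp_zero.
  by have [_ E] := Cp_add (ms n) (my n); rewrite [LHS](E i ip t tab) IH.
have ex i : exists x, (i <= p)%N -> C_mem a b x /\
    forall n t, a <= t <= b -> Dist (nd i (s n) t) (x t) <= 2 * 4^-1 ^+ n.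
  have [ip|pi] := leqP i p; last by exists (@fpzero R).
  have myi n : C_mem a b (nd i (y n)) := (my n i ip).1.
  have [|x mx Hx] := sup_series CF myi.
    (* The norm of the i-th derivative is one summand of the C^p norm, so the derivatives inherit
       the decay rate. *)
    move=> n; apply: le_trans (y4 n); rewrite (Cp_snorm (my n)).
    rewrite (bigD1 (Ordinal (ip : (i < p.+1)%N))) //= lerDl; apply: sumr_ge0 => j _.
    by apply: (cone_ge0 CM); [exact: cone_zero CM|exact: (mem_ord j (my n))].
  by exists x => _; split=> // n t tab; rewrite sE //; exact: Hx.
have [x Hx] := choice ex.
have unif i : (i <= p)%N -> forall e, 0 < e -> exists N, forall n, (N <= n)%N ->
    forall t, a <= t <= b -> Dist (nd i (s n) t) (x i t) <= e.
  move=> ip e e0; have [N HN] := quarter_pow_small 2 e0; exists N => n Nn t tab.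
  by apply: le_trans ((Hx i ip).2 n t tab) (HN n Nn).
have [mx xE] : Cp_mem a b p (x 0%N) /\
    forall i, (i <= p)%N -> forall t, a <= t <= b -> nd i (x 0%N) t = x i t.
  (* The limits of the derivatives of successive orders form the tower. *)
  apply: Cp_char => // [i ip|i ip]; first exact: (Hx i ip).1.
  have ff j n : (j <= p)%N -> fuzzy_on (nd j (s n)) by move=> jp; have [[]] := ms n j jp.
  apply: (@limit_Hderiv_at (fun n => nd i (s n)) (fun n => nd i.+1 (s n))).
  - by have [[]] := Hx i (ltnW ip).
  - exact: (Hx i.+1 ip).1.
  - by move=> n; apply: ff; exact: ltnW.
  - by move=> n; exact: ff.
  - by move=> n t tab; exact: Cp_nderiv_at.
  - by apply: unif; exact: ltnW.
  - exact: unif.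
exists (x 0%N) => // e e0.
(* Each of the [p + 1] orders of derivation contributes at most [2 * 4^-n]. *)
have [N HN] := quarter_pow_small (2 * p.+1%:R) e0; exists N => n Nn.
apply: le_trans (HN n Nn).
have -> : 2 * p.+1%:R * 4^-1 ^+ n = \sum_(i < p.+1) 2 * 4^-1 ^+ n :> R.
  by rewrite sumr_const card_ord -mulr_natr; ring.
apply: ler_sum => i _; apply: (@supD_le R R _ (C_mem a b) CF) => t tab.
by rewrite (xE i (ltn_ord i) t tab); apply: (Hx i (ltn_ord i)).2.
Qed.

End Cp.
End HukuharaDerivative.

(** * Admissible spaces *)

Section Admissible.
Variable R : realType.

Lemma measurable_segment (a b : R) : measurable (itv a b).
Proof.
have -> : itv a b = `[a, b]%classic by apply/seteqP; split=> t; rewrite /itv /= in_itv.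
exact: measurable_itv.
Qed.

Lemma Lp_spaceE (a b p : R) :
  Lp_space a b p = Lebesgue_space lebesgue_measure (itv a b) p.
Proof. reflexivity. Qed.

Lemma lp_powint (p : R) (x y : nat -> R -> R) :
  powint counting [set: nat] p (fun n => Dist (x n) (y n)) =
  (\sum_(0 <= n <oo) ((Dist (x n) (y n)) `^ p)%R%:E)%E.
Proof. by rewrite /powint ge0_integral_count // => n; rewrite lee_fin powR_ge0. Qed.

(* A sequence space is a Lebesgue space for the counting measure on [nat],
   where every function is measurable. *)
Lemma lp_spaceE (p : R) : lp_space p = Lebesgue_space counting [set: nat] p.
Proof.
congr FSpace.
  apply/funext => x; apply/propext; rewrite /lp_mem /Lebesgue_mem lp_powint.
  by split=> [[fx ltx]|[fx _ ltx]]; split=> // n; exact: fx.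
by apply/funext => x; apply/funext => y; rewrite /rho /pnorm lp_powint.
Qed.

Lemma admissible_complete_cone (X : fspace R) : admissible X -> metric_cone X /\ series_complete X.
Proof.
elim=> [|a b ab|a b p ab p1|a b p ab|p p1||||Y Z _ [mY cY] _ [mZ cZ]].
- by split; [exact: RF_metric_cone|exact: RF_series_complete].
- by split; [exact: (sup_metric_cone (C_family ab))|exact: (sup_series_complete (C_family ab))].
- have mS := measurable_segment a b; rewrite Lp_spaceE; split.
    exact: (Lebesgue_metric_cone lebesgue_measure mS p1).
  exact: (@Lebesgue_series_complete _ _ _ lebesgue_measure _ _ mS p1).
- by split; [exact: Cp_metric_cone|exact: Cp_series_complete].
- rewrite lp_spaceE; split.
    exact: (Lebesgue_metric_cone counting measurableT p1).
  exact: (@Lebesgue_series_complete _ _ _ counting _ _ measurableT p1).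
- by split; [exact: (sup_metric_cone (m_family R))|exact: (sup_series_complete (m_family R))].
- by split; [exact: (sup_metric_cone (c_family R))|exact: (sup_series_complete (c_family R))].
- by split; [exact: (sup_metric_cone (c0_family R))|exact: (sup_series_complete (c0_family R))].
- by split; [exact: prod_metric_cone|exact: prod_series_complete].
Qed.

End Admissible.

Theorem theorem3p7 (R : realType) (X : fspace R) (hX : admissible X)
  (plus : bool) (J : Type) (A : J -> car X -> car X)
  (hA : forall j, if plus then LFplus (A j) else LF (A j))
  (hbd : forall x, inX x -> exists Mx : R, forall j, snorm (A j x) <= Mx) :
  exists2 M : R, 0 < M & forall j, (opnorm (A j) <= M%:E)%E.
Proof.
have [mX cX] := admissible_complete_cone hX.
(* Homogeneity for all reals contains positive homogeneity, so both classes of operators reduce to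
   the larger one. *)
have hP j : LFplus (A j).
  by case: plus hA => // hA; have [? ? hom ?] := hA j; split=> // l x _; exact: hom.
by apply: (uniformly_bounded mX cX _ _ _ _ hbd) => j; have [] := hP j.
Qed.
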